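(* Let $n\ge 1$ be an integer and let $A$ be a bounded linear operator on a complex Hilbert space which is quasi-analytic, is a strict $2n$-isometry, and satisfies $A^*A-I=w\otimes w$ for some vector $w$ of the space. Then there is a rational function $b$ of degree $n$ in the unit ball of $H^\infty$ with $b(0)=0$ such that $A$ is unitarily equivalent to $(M_z,H(b))$, the operator of multiplication by $z$ on $H(b)$.
   Context: $\mathbb D$ is the open unit disc, $H^2$ the Hardy space on $\mathbb D$, $H^\infty$ the bounded analytic functions on $\mathbb D$ with the sup norm. For vectors $x,y$, $x\otimes y$ is the operator $f\mapsto \langle f,y\rangle x$. For $b$ in the closed unit ball of $H^\infty$, the de Branges–Rovnyak space $H(b)$ is the range of $(I-T_bT_{\overline b})^{1/2}$ on $H^2$ ($T_\phi f=P(\phi f)$ the Toeplitz operator, with $P$ the orthogonal projection of $L^2(\mathbb T)$ onto $H^2$) with the range norm making $(I-T_bT_{\overline b})^{1/2}$ a coisometry onto $H(b)$; equivalently, it is the reproducing kernel Hilbert space on $\mathbb D$ with kernel $K^b_\lambda(z)=\frac{1-\overline{b(\lambda)}b(z)}{1-\overline\lambda z}$. $(M_z,H(b))$ denotes the operator $f\mapsto zf$ on $H(b)$; it is a bounded operator on $H(b)$ if and only if $b$ is a nonextreme point of the unit ball of $H^\infty$. For a bounded operator $T$ and $m\ge1$ let $\beta_m(T)=\sum_{k=0}^m(-1)^{m-k}\binom mk T^{*k}T^k$. $T$ is an $m$-isometry if $\beta_m(T)=0$; it is a strict $m$-isometry if it is an $m$-isometry but not an $(m-1)$-isometry. A bounded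 operator $T$ on a Hilbert space is expansive if $\Delta:=T^*T-I\ge 0$. For expansive $T$, let $\mathcal M=[\mathrm{ran}\,\Delta]_{T^*}$ be the smallest closed $T^*$-invariant subspace containing the range of $\Delta$. An expansive operator $T$ is called quasi-analytic if the restriction $T|\mathcal M^\perp$ is unitarily equivalent to the unilateral shift $S=(M_z,H^2)$, i.e. multiplication by $z$ on $H^2$. *)

(* Defs.v *)
From HB Require Import structures.
From mathcomp Require Import all_boot all_order all_algebra.
From mathcomp Require Import all_classical all_reals all_analysis.
From mathcomp Require Import sesquilinear complex.

Set Implicit Arguments.
Unset Strict Implicit.
Unset Printing Implicit Defensive.

Import Order.TTheory GRing.Theory Num.Theory.
Import numFieldNormedType.Exports.

Local Open Scope classical_set_scope.
Local Open Scope ring_scope.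

(* The topology of MathComp-Analysis is found on R[i] only when R[i] is
   presented as a numeric field, hence this packaged version. *)
Definition Cplx (R : realType) : numClosedFieldType := R[i].

(* The norm takes its values in Cplx R (in its nonnegative real part), as for
   every normed module over Cplx R.  hdot is linear in its first argument. *)
Record hilbertType (R : realType) := HilbertType {
  hilbert_sort :> completeNormedModType (Cplx R);
  hdot : {dot hilbert_sort for (@Num.conj (Cplx R))};
  hilbert_normE : forall x : hilbert_sort, `|x| ^+ 2 = hdot x x }.

Arguments hdot {R h}.

Section Operators.
Context {R : realType}.
Implicit Types H K : hilbertType R.

Definition bounded_op H K (T : H -> K) : Prop :=
  exists M : Cplx R, forall x : H, `|T x| <= M * `|x|.

(* For a bounded linear T the defining set is a singleton (Riesz), so the
   default value 0 is not used. *)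
Definition adjoint H (T : H -> H) (y : H) : H :=
  xget 0 [set z : H | forall x : H, hdot (T x) y = hdot x z].

Definition rank_one H (x y : H) (f : H) : H := hdot f y *: x.

Definition beta H (m : nat) (T : H -> H) (x : H) : H :=
  \sum_(k < m.+1)
    ((-1) ^+ (m - k) * ('C(m, k))%:R) *: iter k (adjoint T) (iter k T x).

Definition m_isometry H (m : nat) (T : H -> H) : Prop :=
  forall x : H, beta m T x = 0.

Definition strict_m_isometry H (m : nat) (T : H -> H) : Prop :=
  m_isometry m T /\ ~ m_isometry m.-1 T.

Definition defect H (T : H -> H) (x : H) : H := adjoint T (T x) - x.

(* On Cplx R, 0 <= z means that z is real and nonnegative. *)
Definition expansive H (T : H -> H) : Prop :=
  forall x : H, 0 <= hdot (defect T x) x.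

Definition closed_subspace H (V : set H) : Prop :=
  [/\ closed V, V 0 & forall (a : Cplx R) (x y : H), V x -> V y -> V (a *: x + y)].

(* [X]_T in the notation of operator theory. *)
Definition invariant_span H (T : H -> H) (X : set H) : set H :=
  \bigcap_(V in [set V : set H | [/\ closed_subspace V,
                                     (forall x, V x -> V (T x)) & X `<=` V]]) V.

Definition orthogonal_compl H (X : set H) : set H :=
  [set x : H | forall y : H, X y -> hdot x y = 0].

(* T is unitarily equivalent to the restriction S|V; the intertwining relation
   together with range U = V forces V to be S-invariant. *)
Definition unitarily_equivalent_restr H K (T : H -> H) (S : K -> K) (V : set K)
    : Prop :=
  exists U : {linear H -> K},
    [/\ forall x y : H, hdot (U x) (U y) = hdot x y,
        range U = V
      & forall x : H, U (T x) = S (U x)].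

Definition unitarily_equivalent H K (T : H -> H) (S : K -> K) : Prop :=
  unitarily_equivalent_restr T S setT.

End Operators.

(* A Hilbert space of functions on the open unit disc: disc_eval f is the
   function f, whose values off the disc are irrelevant. *)
Record discSpace (R : realType) := DiscSpace {
  disc_hilbert :> hilbertType R;
  disc_eval : disc_hilbert -> Cplx R -> Cplx R;
  disc_eval_linear : forall (a : Cplx R) (f g : disc_hilbert) (z : Cplx R),
    `|z| < 1 ->
    disc_eval (a *: f + g) z = a * disc_eval f z + disc_eval g z;
  disc_eval_inj : forall f : disc_hilbert,
    (forall z : Cplx R, `|z| < 1 -> disc_eval f z = 0) -> f = 0 }.

Arguments disc_eval {R d}.

Section FunctionSpaces.
Context {R : realType}.
Implicit Types E : discSpace R.

Definition is_mult_z E (M : E -> E) : Prop :=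
  forall (f : E) (z : Cplx R), `|z| < 1 -> disc_eval (M f) z = z * disc_eval f z.

Definition taylor_on_disc (a : nat -> Cplx R) (f : Cplx R -> Cplx R) : Prop :=
  forall z : Cplx R, `|z| < 1 ->
    series (fun n => a n * z ^+ n) @ \oo --> f z.

(* E is H^2: its elements are exactly the functions analytic on the disc with
   square-summable Taylor coefficients (a_n), and ||f||^2 = sum_n |a_n|^2. *)
Definition is_hardy_space E : Prop :=
  (forall f : E, exists a : nat -> Cplx R,
     taylor_on_disc a (disc_eval f) /\
     series (fun n => `|a n| ^+ 2) @ \oo --> `|f| ^+ 2) /\
  (forall a : nat -> Cplx R, cvg (series (fun n => `|a n| ^+ 2) @ \oo) ->
     exists f : E, taylor_on_disc a (disc_eval f)).

(* E is the reproducing kernel Hilbert space on the disc whose kernel function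
   at l is K l. *)
Definition is_rkhs (K : Cplx R -> Cplx R -> Cplx R) E : Prop :=
  forall l : Cplx R, `|l| < 1 ->
    exists k : E,
      (forall z : Cplx R, `|z| < 1 -> disc_eval k z = K l z) /\
      (forall f : E, disc_eval f l = hdot f k).

Definition dBR_kernel (b : Cplx R -> Cplx R) (l z : Cplx R) : Cplx R :=
  (1 - (b l)^* * b z) / (1 - l^* * z).

(* E is H(b). *)
Definition is_dBR_space (b : Cplx R -> Cplx R) E : Prop :=
  is_rkhs (dBR_kernel b) E.

(* Analyticity is complex differentiability at every point of the disc. *)
Definition in_Hinfty_ball (b : Cplx R -> Cplx R) : Prop :=
  forall z : Cplx R, `|z| < 1 -> derivable b z 1 /\ `|b z| <= 1.

(* The degree is max(deg p, deg q) for b = p / q in lowest terms. *)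
Definition rational_of_degree (n : nat) (b : Cplx R -> Cplx R) : Prop :=
  exists p q : {poly Cplx R},
    [/\ coprimep p q, maxn (size p).-1 (size q).-1 = n
      & forall z : Cplx R, `|z| < 1 -> q.[z] != 0 /\ b z = p.[z] / q.[z]].

Definition quasi_analytic (H : hilbertType R) (T : H -> H) : Prop :=
  expansive T /\
  exists (E : discSpace R) (S : E -> E),
    [/\ is_hardy_space E, is_mult_z S
      & unitarily_equivalent_restr S T
          (orthogonal_compl (invariant_span (adjoint T) (range (defect T))))].

(* T is unitarily equivalent to (M_z, H(b)); in particular M_z is bounded on
   H(b).  The kernel determines H(b), so the choice of E is immaterial. *)
Definition unitarily_equivalent_Mz_dBR (H : hilbertType R) (T : H -> H)
    (b : Cplx R -> Cplx R) : Prop :=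
  exists (E : discSpace R) (M : {linear E -> E}),
    [/\ is_dBR_space b E, bounded_op M, is_mult_z M
      & unitarily_equivalent T M].

End FunctionSpaces.

(* Main.v *)
From HB Require Import structures.
Require Import Defs.
From mathcomp Require Import all_boot all_order all_algebra.
From mathcomp Require Import all_classical all_reals all_analysis.
From mathcomp Require Import sesquilinear complex zify ring lra.

Set Implicit Arguments.
Unset Strict Implicit.
Unset Printing Implicit Defensive.

Import Order.TTheory GRing.Theory Num.Theory.
Import numFieldNormedType.Exports.

Local Open Scope classical_set_scope.
Local Open Scope ring_scope.

(** The operator A is already multiplication by z on a space of functions on
    the disc: the space H itself, once its elements are read as functions.
    Write T for the adjoint of A and w_k = T^k w.

    Structure of T.  Since T A = 1 + w (x) w, the differences beta_m are the
    iterated differences of the rank one operators w_k (x) w_k.  Vanishing of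
    beta_(2n) makes w a vector of finite type for T; its eigenvalues are forced
    to be one number z with |z| = 1 ([eigenvalue_nilpotent]), and counting the
    order of the difference operator on a Jordan chain shows that the chain
    generated by w has length exactly n ([adjoint_unipotent]).  So the space M
    of quasi-analyticity is n-dimensional with basis w_0 .. w_(n-1), and T is
    invertible on it.  The orthogonal complement N of M carries a unilateral
    shift, which has one wandering vector; correcting that vector by an element
    of M gives a unit vector e spanning ker T ([kernel_adjoint_line]).

    Functions.  L = (T A)^-1 T is a left inverse of A with kernel ker T, hence
    f = A (L f) + <f, e> e, and the adjoint of L is a contraction.  For |l| < 1
    the Neumann series gives k_l with k_l = e + conj l L^adj k_l, and
    f |-> (l |-> <f, k_l>) turns A into multiplication by l.  Computing the
    Gram matrix with (T A)^-1 = 1 - c w (x) w, c = 1 / (1 + |w|^2), gives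
      <k_l, k_l'> (1 - conj l l') = 1 - conj (b l) b l',
      b l = sqrt c  l <w, k_l>                                ([hdot_kernel2]),
    which is the kernel of H(b), and |b| <= 1 by positivity on the diagonal.
    The transform is injective: if it kills f, then f = A^j (L^j f) for all j;
    the backward orbit L^j f has square summable components along w, which
    unipotence of T turns into vanishing components along M, and on N the shift
    is pure ([backward_orbit0]).

    Rationality.  M is L-invariant and L differs from T by multiples of w, so w
    has a minimal polynomial chi of degree n for L too, with nonzero constant
    term.  Reversing chi gives a denominator Q with Q l <w, k_l> = P l and
    deg P < n ([symbol_equation]).  A common root of P and Q would yield an
    eigenvector of L orthogonal to e, whose transform vanishes
    ([symbol_no_common_root]); hence b = sqrt c z P / Q has degree n. *)

(** * Inner products *)

Section InnerProduct.
Context {R : realType}.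
Implicit Types (H : hilbertType R) (a : Cplx R).

Lemma hdotC H (x y : H) : hdot x y = (hdot y x)^*.
Proof. by rewrite (@hermC _ false (@Num.conj (Cplx R))) expr0 mul1r. Qed.

Lemma hdotDl H (x y z : H) : hdot (x + y) z = hdot x z + hdot y z.
Proof. by rewrite linearDl. Qed.

Lemma hdotZl H a (x z : H) : hdot (a *: x) z = a * hdot x z.
Proof. by rewrite linearZl_LR. Qed.

Lemma hdotZr H a (x z : H) : hdot x (a *: z) = a^* * hdot x z.
Proof. by rewrite linearZr_LR. Qed.

Lemma hdotDr H (x y z : H) : hdot x (y + z) = hdot x y + hdot x z.
Proof. by rewrite linearDr. Qed.

Lemma hdotNl H (x z : H) : hdot (- x) z = - hdot x z.
Proof. by rewrite -scaleN1r hdotZl mulN1r. Qed.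

Lemma hdotNr H (x z : H) : hdot x (- z) = - hdot x z.
Proof. by rewrite linearNr. Qed.

Lemma hdotBl H (x y z : H) : hdot (x - y) z = hdot x z - hdot y z.
Proof. by rewrite hdotDl hdotNl. Qed.

Lemma hdotBr H (x y z : H) : hdot x (y - z) = hdot x y - hdot x z.
Proof. by rewrite hdotDr hdotNr. Qed.

Lemma hdot0l H (x : H) : hdot 0 x = 0.
Proof. by rewrite -(scale0r x) hdotZl mul0r. Qed.

Lemma hdot0r H (x : H) : hdot x 0 = 0.
Proof. by rewrite linear0r. Qed.

Lemma hdot_suml H (I : Type) (r : seq I) (P : pred I) (F : I -> H) (z : H) :
  hdot (\sum_(i <- r | P i) F i) z = \sum_(i <- r | P i) hdot (F i) z.
Proof.
by elim/big_rec2: _ => [|i y x _ <-]; rewrite ?hdot0l // hdotDl.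
Qed.

Lemma hdot_sumr H (I : Type) (r : seq I) (P : pred I) (F : I -> H) (z : H) :
  hdot z (\sum_(i <- r | P i) F i) = \sum_(i <- r | P i) hdot z (F i).
Proof.
by elim/big_rec2: _ => [|i y x _ <-]; rewrite ?hdot0r // hdotDr.
Qed.

Lemma hdotxx_ge0 H (x : H) : 0 <= hdot x x.
Proof. by rewrite -hilbert_normE exprn_ge0. Qed.

Lemma hdotxx_eq0 H (x : H) : (hdot x x == 0) = (x == 0).
Proof. by rewrite -hilbert_normE expf_eq0 /= normr_eq0. Qed.

Lemma hdotl_eq0 H (x : H) : (forall y, hdot y x = 0) -> x = 0.
Proof. by move=> /(_ x)/eqP; rewrite hdotxx_eq0 => /eqP. Qed.

Lemma hdotl_inj H (x y : H) : (forall v, hdot v x = hdot v y) -> x = y.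
Proof.
by move=> h; apply/eqP; rewrite -subr_eq0; apply/eqP/hdotl_eq0 => v;
  rewrite hdotBr h subrr.
Qed.

Lemma hdotr_inj H (x y : H) : (forall v, hdot x v = hdot y v) -> x = y.
Proof. by move=> h; apply: hdotl_inj => v; rewrite hdotC h -hdotC. Qed.

Lemma norm_sub_component H (x v : H) : v != 0 ->
  `|x - (hdot x v / hdot v v) *: v| ^+ 2 = `|x| ^+ 2 - `|hdot x v| ^+ 2 / `|v| ^+ 2.
Proof.
rewrite -hdotxx_eq0 => v0; set t := _ / _.
have tc : t^* = hdot v x / hdot v v.
  by rewrite /t rmorphM fmorphV /= -(hdotC v x) -(hdotC v v).
rewrite !hilbert_normE hdotBr !hdotBl !hdotZr !hdotZl tc normCK -(hdotC v x) /t.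
by field.
Qed.

Lemma cauchy_schwarz H (x y : H) : `|hdot x y| <= `|x| * `|y|.
Proof.
have [->|y0] := eqVneq y 0; first by rewrite hdot0r !normr0 mulr0.
rewrite -(@ler_pXn2r _ 2) ?nnegrE ?mulr_ge0 // exprMn.
have y2 : 0 < `|y| ^+ 2 by rewrite exprn_gt0 ?normr_gt0.
rewrite -ler_pdivrMr // -subr_ge0 -norm_sub_component // exprn_ge0 //.
Qed.

Lemma parallelogram H (x y : H) :
  `|x + y| ^+ 2 + `|x - y| ^+ 2 = 2 * `|x| ^+ 2 + 2 * `|y| ^+ 2.
Proof.
rewrite !hilbert_normE hdotBr !hdotBl !hdotDr !hdotDl; ring.
Qed.

End InnerProduct.

(** * Limits and completeness over the complex numbers *)

Section Completeness.
Context {R : realType}.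

(** The order of the scalar field is partial, so facts of the real line are
    obtained on real parts. *)
Lemma natSinv_lt (e : Cplx R) : 0 < e -> exists N, forall m,
  (N <= m)%N -> m.+1%:R^-1 < e.
Proof.
move=> e0; have er : e = (complex.Re e)%:C%C.
  by rewrite RRe_real // gtr0_real.
have r0 : 0 < complex.Re e by rewrite -ltcR -er.
have [N hN] : exists N, forall m, (N <= m)%N -> m.+1%:R^-1 < complex.Re e.
  have [N _ hN] := near_infty_natSinv_lt (PosNum r0).
  by exists N => m mN; exact: hN.
exists N => m /hN; rewrite -ltcR -er => h.
by apply: le_lt_trans h; rewrite fmorphV rmorph_nat.
Qed.

Lemma cvg_distP (V : normedModType (Cplx R)) (u : nat -> V) l :
  u @ \oo --> l <->
  forall e, 0 < e -> exists N, forall m, (N <= m)%N -> `|u m - l| < e.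
Proof.
split=> [/cvgrPdist_lt h e e0|h].
  have [N _ hN] := h e e0; exists N => m mN.
  by rewrite distrC; apply: hN.
apply/cvgrPdist_lt => e e0; have [N hN] := h e e0.
by exists N => // m /= mN; rewrite distrC hN.
Qed.

Lemma cauchy_dist_cvg (V : completeNormedModType (Cplx R)) (u : nat -> V) :
  (forall e, 0 < e -> exists N, forall m k, (N <= m)%N -> (N <= k)%N ->
     `|u m - u k| < e) ->
  exists l : V, u @ \oo --> l.
Proof.
move=> h; apply/cvg_ex.
apply/cauchy_cvgP/cauchy_ballP => e e0.
have [N hN] := h e e0.
exists (u @` [set m | (N <= m)%N], u @` [set m | (N <= m)%N]).
  by split; exists N => // m mN; exists m.
by move=> [_ _] /= [[m mN <-] [k kN <-]]; rewrite -ball_normE /=; apply: hN.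
Qed.

Lemma lipschitz_preimage_closed (V W : normedModType (Cplx R)) (g : V -> W) M
    (A : set W) :
  (forall x y, `|g x - g y| <= M * `|x - y|) -> closed A -> closed (g @^-1` A).
Proof.
move=> gM; apply: (continuous_closedP g).1 => x.
have M1 : 0 < `|M| + 1 by rewrite ltr_wpDl.
apply/cvgrPdist_lt => e e0; near=> y.
apply: le_lt_trans (gM _ _) _.
apply: (@le_lt_trans _ _ ((`|M| + 1) * `|x - y|)).
  have h := le_trans (normr_ge0 _) (gM x y).
  by rewrite -(ger0_norm h) normrM normr_id ler_wpM2r // lerDl.
rewrite mulrC -ltr_pdivlMr //; near: y.
exact: (cvgr_dist_lt id x (@cvg_id _ (nbhs x)) _ (divr_gt0 e0 M1)).
Unshelve. all: by end_near. Qed.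

Lemma closed_seq_lim (H : hilbertType R) (V : set H) (u : nat -> H) l :
  closed V -> (forall n, V (u n)) -> u @ \oo --> l -> V l.
Proof.
by move=> Vc Vu ul; apply: (closed_cvg V Vc _ _ ul); apply: nearW.
Qed.

Lemma lim_norm_le (V : normedModType (Cplx R)) (u : nat -> V) l (B : Cplx R) :
  u @ \oo --> l -> (forall m, `|u m| <= B) -> `|l| <= B.
Proof.
move=> /cvg_distP ul uB; apply/ler_addgt0Pr => e e0.
have [N hN] := ul e e0.
have -> : l = u N - (u N - l) by rewrite opprB addrC subrK.
by rewrite (le_trans (ler_normB _ _)) // lerD // ltW ?hN.
Qed.

Lemma lim_unique_dist (V : normedModType (Cplx R)) (u : nat -> V) l l' :
  u @ \oo --> l -> (forall e : Cplx R, 0 < e ->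
     exists N, forall m, (N <= m)%N -> `|u m - l'| < e) ->
  l = l'.
Proof.
move=> /cvg_distP ul ul'; apply/eqP; rewrite -subr_eq0 -normr_le0.
apply/ler_addgt0Pr => e e0; rewrite add0r.
have e2 : 0 < e / 2 by rewrite divr_gt0.
have [N hN] := ul _ e2; have [N' hN'] := ul' _ e2.
pose m := maxn N N'.
have -> : l - l' = (u m - l') - (u m - l) by rewrite opprB [RHS]addrC addrA subrK.
rewrite (le_trans (ler_normB _ _)) // (splitr e) lerD // ltW //.
  by apply: hN'; rewrite leq_maxr.
by apply: hN; rewrite leq_maxl.
Qed.

Lemma lim_ge_real (u : nat -> Cplx R) (l c : Cplx R) N : l \is Num.real ->
  u @ \oo --> l -> (forall m, (N <= m)%N -> c <= u m) ->
  (forall m, u m \is Num.real) -> c <= l.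
Proof.
move=> lr /cvg_distP ul cu ur; apply/ler_addgt0Pr => e e0.
have [N' hN] := ul e e0.
apply: (le_trans (cu (maxn N N') (leq_maxl _ _))).
rewrite -lerBlDl (le_trans (real_ler_norm _)) ?rpredB //.
by rewrite ltW // hN // leq_maxr.
Qed.

Lemma expr_small (r : Cplx R) : 0 <= r -> r < 1 -> forall e, 0 < e ->
  exists N, forall m, (N <= m)%N -> r ^+ m < e.
Proof.
move=> r0 r1 e e0.
have er : e = (complex.Re e)%:C%C by rewrite RRe_real // gtr0_real.
have rr : r = (complex.Re r)%:C%C by rewrite RRe_real // ger0_real.
have e0' : 0 < complex.Re e by rewrite -ltcR -er.
have r1' : `|complex.Re r| < 1.
  rewrite ger0_norm; first by rewrite -ltcR -rr.
  by rewrite -lecR -rr.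
have := cvg_expr r1' => /cvgrPdist_lt /(_ _ e0') [N _ hN].
exists N => m mN; rewrite rr er -rmorphXn ltcR.
by have := hN m mN; rewrite /= sub0r normrN; apply: le_lt_trans; apply: ler_norm.
Qed.

Lemma geometric_sum_le (r : Cplx R) m : 0 <= r -> r < 1 ->
  \sum_(i < m) r ^+ i <= (1 - r)^-1.
Proof.
move=> r0 r1; have r1' : 0 < 1 - r by rewrite subr_gt0.
rewrite -[leRHS]mul1r ler_pdivlMr // mulrC -opprB mulNr -subrX1 opprB.
by rewrite gerBl exprn_ge0.
Qed.

End Completeness.

(** * Orthogonal projections, the Riesz theorem and adjoints *)

Section Projection.
Context {R : realType}.
Implicit Types H : hilbertType R.

Lemma closed_subspaceZ H (V : set H) a x : closed_subspace V -> V x -> V (a *: x).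
Proof. by case=> _ V0 Vl Vx; rewrite -[_ *: _]addr0; apply: Vl. Qed.

Lemma closed_subspaceD H (V : set H) x y :
  closed_subspace V -> V x -> V y -> V (x + y).
Proof. by case=> _ V0 Vl Vx Vy; rewrite -[x]scale1r; apply: Vl. Qed.

Lemma closed_subspaceB H (V : set H) x y :
  closed_subspace V -> V x -> V y -> V (x - y).
Proof.
move=> cV Vx Vy; apply: closed_subspaceD => //.
by rewrite -scaleN1r; apply: closed_subspaceZ.
Qed.

Lemma sqnorm_real H (x : H) : `|x| ^+ 2 = (complex.Re (`|x| ^+ 2))%:C%C.
Proof. by rewrite RRe_real // rpredX // normr_real. Qed.

(** A minimizing sequence is Cauchy by the parallelogram identity, because the
    midpoint of two of its terms is not nearer to x than the infimum. *)
Lemma exists_nearest H (V : set H) (x : H) : closed_subspace V ->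
  exists2 v, V v & forall u, V u -> `|x - v| ^+ 2 <= `|x - u| ^+ 2.
Proof.
move=> cV; have [Vc V0 _] := cV.
pose S := [set complex.Re (`|x - v| ^+ 2) | v in V] : set R.
have S_lb : lbound S 0.
  by move=> _ [v _ <-]; rewrite -lecR -sqnorm_real exprn_ge0.
have hS : has_inf S by split; [exists (complex.Re (`|x - 0| ^+ 2)), 0 | exists 0].
pose d : Cplx R := (inf S)%:C%C.
have d_le u : V u -> d <= `|x - u| ^+ 2.
  by move=> Vu; rewrite sqnorm_real /d lecR; apply: ge_inf; [exists 0 | exists u].
have near_min n : exists v, V v /\ `|x - v| ^+ 2 < d + n.+1%:R^-1.
  have n0 : (0 : R) < n.+1%:R^-1 by rewrite invr_gt0.
  have [_ [v Vv <-] h] := inf_adherent n0 hS.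
  exists v; split => //; rewrite sqnorm_real /d.
  by move: h; rewrite -ltcR rmorphD /= fmorphV rmorph_nat.
have [v hv] := choice near_min.
have Vv n : V (v n) by case: (hv n).
have v_dist m k : `|v m - v k| ^+ 2 <= 2 * m.+1%:R^-1 + 2 * k.+1%:R^-1.
  have := parallelogram (x - v m) (x - v k).
  have -> : x - v m - (x - v k) = v k - v m.
    by rewrite opprB addrC addrA subrK.
  have -> : x - v m + (x - v k) = 2 *: (x - 2^-1 *: (v m + v k)).
    rewrite scalerBr scalerA divff ?pnatr_eq0 // scale1r scaler_nat mulr2n opprD.
    by rewrite addrACA.
  have hmid : d <= `|x - 2^-1 *: (v m + v k)| ^+ 2.
    by apply: d_le; apply: closed_subspaceZ => //; apply: closed_subspaceD.
  rewrite normrZ ger0_norm // exprMn (distrC (v k)) => hp.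
  have -> : `|v m - v k| ^+ 2 = 2 * `|x - v m| ^+ 2 + 2 * `|x - v k| ^+ 2
    - 2 ^+ 2 * `|x - 2^-1 *: (v m + v k)| ^+ 2 by rewrite -hp; ring.
  have [_ /ltW hm] := hv m; have [_ /ltW hk] := hv k.
  rewrite lerBlDr; apply: (@le_trans _ _ (2 * (d + m.+1%:R^-1) + 2 * (d + k.+1%:R^-1))).
    by apply: lerD; rewrite ler_pM2l.
  have -> : 2 * (d + m.+1%:R^-1) + 2 * (d + k.+1%:R^-1)
    = 2 * m.+1%:R^-1 + 2 * k.+1%:R^-1 + 2 ^+ 2 * d by ring.
  by rewrite lerD2l ler_pM2l // exprn_gt0.
have [l vl] : exists l : H, v @ \oo --> l.
  apply: cauchy_dist_cvg => e e0.
  have e4 : 0 < e ^+ 2 / 4 by rewrite divr_gt0 ?exprn_gt0.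
  have [N hN] := natSinv_lt e4; exists N => m k mN kN.
  rewrite -(@ltr_pXn2r _ 2) ?nnegrE ?(ltW e0) //.
  apply: le_lt_trans (v_dist m k) _.
  have -> : e ^+ 2 = 2 * (e ^+ 2 / 4) + 2 * (e ^+ 2 / 4) by field.
  by apply: ltrD; rewrite ltr_pM2l ?hN.
exists l; first exact: closed_seq_lim vl.
suff -> : `|x - l| ^+ 2 = d by [].
apply/eqP; rewrite eq_le d_le ?andbT; last exact: closed_seq_lim vl.
(* |x - l| <= b + c with b^2 < d + e/2 and c = |v m - l| small; the constant
   2a + 4 dominates 2b + c, as b <= a + c and c <= 1. *)
apply/ler_addgt0Pr => e e0; set a := `|x - l|.
have a0 : 0 <= a by exact: normr_ge0.
have K0 : 0 < 2 * a + 4 by rewrite ltr_wpDl ?mulr_ge0 ?ltr0n.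
have e2 : 0 < e / 2 by rewrite divr_gt0.
have [N1 hN1] := natSinv_lt e2.
have [N2 hN2] := (cvg_distP v l).1 vl 1 ltr01.
have [N3 hN3] := (cvg_distP v l).1 vl (e / 2 / (2 * a + 4))
  (divr_gt0 e2 K0).
pose m := maxn N1 (maxn N2 N3).
have /ltW c1 : `|v m - l| < 1 by apply: hN2; rewrite !leq_max leqnn orbT.
have : `|v m - l| < e / 2 / (2 * a + 4) by apply: hN3; rewrite !leq_max leqnn !orbT.
rewrite ltr_pdivlMr // => /ltW c2.
have /ltW m2 : m.+1%:R^-1 < e / 2 by apply: hN1; rewrite leq_max leqnn.
have [_ /ltW hb] := hv m.
have ab : a <= `|x - v m| + `|v m - l|.
  by rewrite /a [x - l](_ : _ = (x - v m) + (v m - l)) ?ler_normD ?addrA ?subrK.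
have ba : `|x - v m| <= a + `|v m - l|.
  by rewrite /a (distrC (v m)) [x - v m](_ : _ = (x - l) + (l - v m)) ?ler_normD ?addrA ?subrK.
set b := `|x - v m| in hb ab ba; set c := `|v m - l| in c1 c2 ab ba.
have b0 : 0 <= b by exact: normr_ge0.
have c0 : 0 <= c by exact: normr_ge0.
apply: (@le_trans _ _ ((b + c) ^+ 2)).
  by rewrite ler_pXn2r ?nnegrE ?addr_ge0 // /a.
have -> : (b + c) ^+ 2 = b ^+ 2 + c * (2 * b + c) by ring.
have -> : d + e = (d + e / 2) + e / 2 by field.
apply: lerD; first by apply: (le_trans hb); rewrite lerD2l.
apply: le_trans c2; rewrite ler_wpM2l //.
apply: (@le_trans _ _ (2 * (a + c) + c)); first by rewrite lerD2r ler_pM2l.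
have -> : 2 * (a + c) + c = 2 * a + 3 * c by ring.
rewrite lerD2l (le_trans (y := 3)) ?ler_nat //.
by rewrite -[leRHS]mulr1 ler_pM2l.
Qed.

(** Subtracting from x - v its component along u would bring it strictly closer
    to V. *)
Lemma exists_projection H (V : set H) (x : H) : closed_subspace V ->
  exists2 v, V v & forall u, V u -> hdot (x - v) u = 0.
Proof.
move=> cV; have [v Vv hv] := exists_nearest x cV; exists v => // u Vu.
have [->|u0] := eqVneq u 0; first by rewrite hdot0r.
have := hv (v + (hdot (x - v) u / hdot u u) *: u).
rewrite opprD addrA norm_sub_component // => /(_ _)/wrap[].
  by apply: closed_subspaceD => //; apply: closed_subspaceZ.
rewrite lerBrDr gerDl => h.
have u2 : 0 < `|u| ^+ 2 by rewrite exprn_gt0 ?normr_gt0.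
have h2 : `|hdot (x - v) u| ^+ 2 <= 0 by rewrite pmulr_lle0 ?invr_gt0 in h.
have : `|hdot (x - v) u| ^+ 2 == 0 by rewrite eq_le h2 exprn_ge0.
by rewrite sqrf_eq0 normr_eq0 => /eqP.
Qed.

(** The nontrivial half of the double orthogonal theorem. *)
Lemma closed_orthogonal_compl_sub H (V : set H) (x : H) : closed_subspace V ->
  (forall y, orthogonal_compl V y -> hdot x y = 0) -> V x.
Proof.
move=> cV h; have [v Vv hv] := exists_projection x cV.
have h1 : hdot x (x - v) = 0 by apply: h => y /hv.
suff /eqP : hdot (x - v) (x - v) = 0.
  by rewrite hdotxx_eq0 subr_eq0 => /eqP ->.
by rewrite hdotBl h1 hdotC hv // conjC0 subrr.
Qed.

(** The representing vector is the component of any x with f x <> 0 orthogonal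
    to the closed hyperplane ker f, suitably scaled. *)
Lemma riesz H (f : H -> Cplx R) (M : Cplx R) :
  (forall a x y, f (a *: x + y) = a * f x + f y) ->
  (forall x, `|f x| <= M * `|x|) ->
  exists z, forall x, f x = hdot x z.
Proof.
move=> fl fM.
have f0 : f 0 = 0 by apply/eqP; rewrite -normr_le0 -(mulr0 M) -(normr0 H) fM.
have fZ a x : f (a *: x) = a * f x by rewrite -[a *: x]addr0 fl f0 addr0.
have fB x y : f (x - y) = f x - f y.
  by rewrite addrC -scaleN1r fl mulN1r addrC.
pose V : set H := [set x | f x = 0].
have cV : closed_subspace V.
  split => //; last by move=> a x y; rewrite /V /= fl => -> ->; rewrite mulr0 addr0.
  apply: (@lipschitz_preimage_closed _ _ (Cplx R) f M [set 0]) => //.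
    by move=> x y; rewrite -fB.
  exact/accessible_closed_set1/hausdorff_accessible/norm_hausdorff.
have [hf|/existsNP[x fx]] := pselect (forall x, f x = 0).
  by exists 0 => x; rewrite hf hdot0r.
have [v Vv hv] := exists_projection x cV.
pose u := x - v; have fxu : f u = f x by rewrite fB Vv subr0.
have u0 : hdot u u != 0.
  by rewrite hdotxx_eq0; apply/eqP => h; apply: fx; rewrite -fxu h f0.
exists ((f x / hdot u u)^* *: u) => y.
rewrite hdotZr conjCK.
have : hdot u (f x *: y - f y *: u) = 0.
  by apply: hv; rewrite /V /= fB !fZ fxu mulrC subrr.
move=> /eqP; rewrite hdotC conjC_eq0 hdotBl !hdotZl subr_eq0 => /eqP e.
by rewrite mulrAC e mulfK.
Qed.

Lemma adjointP H (T : H -> H) :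
  (forall a x y, T (a *: x + y) = a *: T x + T y) -> bounded_op T ->
  forall x y, hdot (T x) y = hdot x (adjoint T y).
Proof.
move=> Tl [M TM] x y; rewrite /adjoint.
suff [z hz] : exists z, forall x, hdot (T x) y = hdot x z.
  by case: xgetP => [w _ /(_ x) //|/(_ z)]; case.
apply: (@riesz _ _ (M * `|y|)) => [a u v|u]; first by rewrite Tl hdotDl hdotZl.
by rewrite mulrAC (le_trans (cauchy_schwarz _ _)) // ler_wpM2r.
Qed.

End Projection.

(** * Polynomials in an operator *)

Lemma linear_map_exists (F : pzRingType) (U V : lmodType F) (f : U -> V) :
  linear f -> exists g : {linear U -> V}, g =1 f.
Proof.
move=> lf.
pose g : {linear U -> V} := HB.pack f (GRing.isLinear.Build F U V *:%R f lf).
by exists g.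
Qed.

Section PolynomialCalculus.
Context {F : fieldType} {V : lmodType F}.
Implicit Types (T : {linear V -> V}) (p q : {poly F}) (x y : V).

Definition opoly T p x : V := \sum_(i < size p) p`_i *: iter i T x.

Lemma opoly_wide T p n x : (size p <= n)%N ->
  opoly T p x = \sum_(i < n) p`_i *: iter i T x.
Proof.
move=> pn; rewrite /opoly (big_ord_widen n (fun i => p`_i *: iter i T x) pn).
rewrite big_mkcond /=; apply: eq_bigr => i _; case: ltnP => // pi.
by rewrite nth_default ?scale0r.
Qed.

Lemma opolyD T p q x : opoly T (p + q) x = opoly T p x + opoly T q x.
Proof.
rewrite (@opoly_wide _ _ (maxn (size p) (size q))) ?size_polyD //.
rewrite (@opoly_wide _ p (maxn (size p) (size q))) ?leq_maxl //.
rewrite (@opoly_wide _ q (maxn (size p) (size q))) ?leq_maxr // -big_split.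
by apply: eq_bigr => i _; rewrite coefD scalerDl.
Qed.

Lemma opolyZ T a p x : opoly T (a *: p) x = a *: opoly T p x.
Proof.
rewrite (@opoly_wide _ _ (size p)) ?size_scale_leq // scaler_sumr.
by apply: eq_bigr => i _; rewrite coefZ scalerA.
Qed.

Lemma opolyB T p q x : opoly T (p - q) x = opoly T p x - opoly T q x.
Proof. by rewrite opolyD -[- q]scaleN1r opolyZ scaleN1r. Qed.

Lemma opolyC T c x : opoly T c%:P x = c *: x.
Proof.
by rewrite (@opoly_wide _ _ 1) ?size_polyC_leq1 // big_ord1 coefC.
Qed.

Lemma opoly0 T x : opoly T 0 x = 0.
Proof. by rewrite /opoly size_poly0 big_ord0. Qed.

Lemma opolyMX T p x : opoly T (p * 'X) x = T (opoly T p x).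
Proof.
rewrite (@opoly_wide _ _ (size p).+1); last first.
  by rewrite (leq_trans (size_polyMleq _ _)) // size_polyX addn2.
rewrite big_ord_recl coefMX scale0r add0r /opoly raddf_sum /=.
by apply: eq_bigr => i _; rewrite coefMX /= linearZ.
Qed.

Lemma opolyX T x : opoly T 'X x = T x.
Proof. by rewrite -['X]mul1r opolyMX opolyC scale1r. Qed.

Lemma opoly_linear T p a x y :
  opoly T p (a *: x + y) = a *: opoly T p x + opoly T p y.
Proof.
elim/poly_ind: p => [|p c ih]; first by rewrite !opoly0 scaler0 addr0.
rewrite !opolyD !opolyMX ih linearP !opolyC !scalerDr !scalerA (mulrC c) addrACA.
by [].
Qed.

Lemma opolyx0 T p : opoly T p 0 = 0.
Proof. by have := opoly_linear T p (-1) 0 0; rewrite !scaler0 addr0 scaleN1r addNr. Qed.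

Lemma opoly_sum T p (I : finType) (c : I -> F) (y : I -> V) :
  opoly T p (\sum_i c i *: y i) = \sum_i c i *: opoly T p (y i).
Proof.
by elim/big_rec2: _ => [|i a b _ <-]; rewrite ?opolyx0 ?opoly_linear.
Qed.

Lemma opolyM T p q x : opoly T (p * q) x = opoly T p (opoly T q x).
Proof.
elim/poly_ind: p => [|p c ih]; first by rewrite mul0r !opoly0.
rewrite mulrDl opolyD -mulrA (mulrC 'X) mulrA opolyMX ih mul_polyC opolyZ.
by rewrite opolyD opolyMX opolyC.
Qed.

Lemma opoly_iter T p i x : opoly T p (iter i T x) = iter i T (opoly T p x).
Proof.
elim: i => //= i <-; rewrite -!opolyX -!opolyM.
by rewrite mulrC.
Qed.

Lemma opoly_eigen T p x z : T x = z *: x -> opoly T p x = p.[z] *: x.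
Proof.
move=> Tx; elim/poly_ind: p => [|p c ih]; first by rewrite opoly0 horner0 scale0r.
by rewrite opolyD opolyMX ih linearZ /= Tx opolyC hornerMXaddC scalerDl scalerA.
Qed.

(** Applying the linear factors one after the other, the last vector before 0
    is an eigenvector. *)
Lemma exists_eigen_factor T (rs : seq F) x : x != 0 ->
  opoly T (\prod_(z <- rs) ('X - z%:P)) x = 0 ->
  exists s z, opoly T s x != 0 /\ T (opoly T s x) = z *: opoly T s x.
Proof.
elim: rs => [|z rs ih] x0.
  by rewrite big_nil opolyC scale1r => h; rewrite h eqxx in x0.
rewrite big_cons opolyM; set y := opoly T _ x => hy.
have [y0|y0] := eqVneq y 0; first exact: ih.
exists (\prod_(j <- rs) ('X - j%:P)), z; split => //.
move: hy; rewrite -/y opolyD opolyX -polyCN opolyC scaleNr => /eqP.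
by rewrite subr_eq0 => /eqP.
Qed.

(** If two operators differ by multiples of x, the vectors r(T) x and r(L) x
    with deg r <= k span the same space for each k, and the change of basis is
    unitriangular: the leading coefficient is kept. *)
Lemma opoly_transfer (T L : {linear V -> V}) x (k : nat) (r : {poly F}) :
  (forall y, exists a, L y = T y + a *: x) -> (size r <= k.+1)%N ->
  exists s : {poly F}, [/\ (size s <= k.+1)%N, s`_k = r`_k & opoly L s x = opoly T r x].
Proof.
move=> LT; elim: k r => [|k ih] r sr.
  by exists r; split => //; rewrite (size1_polyC sr) !opolyC.
have [r' [c er]] : exists r' c, r = r' * 'X + c%:P.
  by elim/poly_ind: (r) => [|q c _]; [exists 0, 0; rewrite mul0r addr0 | exists q, c].
have sr' : (size r' <= k.+1)%N.
  have [->|r'0] := eqVneq r' 0; first by rewrite size_poly0.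
  by move: sr; rewrite er size_MXaddC (negPf r'0).
have [s' [ss' cs' es']] := ih r' sr'.
have [a ea] := LT (opoly L s' x).
exists (s' * 'X + (c - a)%:P); split.
- by rewrite size_MXaddC; case: ifP.
- by rewrite er !coefD !coefMX !coefC /= !addr0.
- rewrite er !opolyD !opolyMX ea es' !opolyC scalerBl -addrA.
  by congr (_ + _); rewrite addrC subrK.
Qed.

End PolynomialCalculus.

(** * Finite differences and the order of a rank one operator *)

Section FiniteDifferences.
Context {V : zmodType}.
Implicit Types (f g : nat -> V).

Definition fdiff f (k : nat) : V := f k.+1 - f k.

Lemma eq_iter_fdiff m f g k : f =1 g -> iter m fdiff f k = iter m fdiff g k.
Proof. by move=> fg; elim: m k => [|m ih] k /=; rewrite ?fg // /fdiff !ih. Qed.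

Lemma iter_fdiffD m f g k :
  iter m fdiff (fun i => f i + g i) k = iter m fdiff f k + iter m fdiff g k.
Proof. by elim: m k => //= m ih k; rewrite /fdiff !ih opprD addrACA. Qed.

Lemma iter_fdiff_shift m f k :
  iter m fdiff (fun i => f i.+1) k = iter m fdiff f k.+1.
Proof. by elim: m k => //= m ih k; rewrite /fdiff !ih. Qed.

End FiniteDifferences.

Lemma morph_iter_fdiff (V W : zmodType) (h : V -> W) m (f : nat -> V) k :
  {morph h : x y / x - y} ->
  h (iter m fdiff f k) = iter m fdiff (fun i => h (f i)) k.
Proof. by move=> hB; elim: m k => //= m ih k; rewrite /fdiff hB !ih. Qed.

Lemma iter_fdiffE (F : comPzRingType) (V : lmodType F) m (f : nat -> V) :
  iter m fdiff f 0 = \sum_(k < m.+1) ((-1) ^+ (m - k) * 'C(m, k)%:R) *: f k.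
Proof.
elim: m f => [|m ih] f; first by rewrite big_ord1 /= expr0 mul1r scale1r.
rewrite iterSr ih [RHS]big_ord_recl bin0 mulr1 subn0.
under [in RHS]eq_bigr => k _ do
  rewrite lift0 subSS binS natrD mulrDr scalerDl.
rewrite big_split /= addrA.
under eq_bigr => k _ do rewrite /fdiff scalerBr.
rewrite sumrB addrC; congr (_ + _).
rewrite [in RHS]big_ord_recr /= bin_small // mulr0 scale0r addr0.
rewrite big_ord_recl bin0 mulr1 subn0 opprD exprS mulN1r scaleNr.
congr (_ + _); rewrite -sumrN; apply: eq_bigr => k _.
by rewrite lift0 -scaleNr -mulNr -mulN1r -exprS subnSK.
Qed.

(** In the next lemmas D j a b stands for the matrix entry of the j-th iterate
    of X |-> T X T^adj - X at N^a w (x) N^b w, where T = z (1 + N), |z| = 1: the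
    recursion is the expansion of (1 + N) x (x) (1 + N) y - x (x) y, and e a,
    f b are the entries of N^a w and N^b w.  Each step raises a or b, so if
    N^d w = 0 everything dies after 2d - 1 steps, while after 2d - 2 steps only
    the entry at (d - 1, d - 1) survives.  In [rank_one_order_top] the letter d
    is the last index of the chain, one less than here. *)
Section RankOneOrder.
Context {F : numFieldType}.
Variables (d : nat) (e f : nat -> F) (D : nat -> nat -> nat -> F).
Hypothesis e0 : forall a, (d <= a)%N -> e a = 0.
Hypothesis f0 : forall a, (d <= a)%N -> f a = 0.
Hypothesis D0 : forall a b, D 0 a b = e a * f b.
Hypothesis DS : forall j a b,
  D j.+1 a b = D j a.+1 b + D j a b.+1 + D j a.+1 b.+1.

Lemma rank_one_order_vanish j a b : (d.*2 <= (j + a + b).+1)%N -> D j a b = 0.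
Proof.
elim: j a b => [|j ih] a b h.
  rewrite D0; have [/e0 ->|ad] := leqP d a; first by rewrite mul0r.
  by rewrite f0 ?mulr0 //; lia.
by rewrite DS !ih ?addr0 //; lia.
Qed.

End RankOneOrder.

(** The number of lattice paths of j unit steps from (a, b) to (d, d). *)
Fixpoint rank_one_coef (d j a b : nat) : nat :=
  if j is j'.+1 then rank_one_coef d j' a.+1 b + rank_one_coef d j' a b.+1
  else (a == d) && (b == d).

Lemma rank_one_coef_gt0 d j a b : (a <= d)%N -> (b <= d)%N ->
  (j + a + b = d.*2)%N -> (0 < rank_one_coef d j a b)%N.
Proof.
elim: j a b => [|j ih] a b ad bd h /=.
  have [-> ->] : a = d /\ b = d by lia.
  by rewrite !eqxx.
rewrite addn_gt0; have [ea|a1] := eqVneq a d.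
  by rewrite (ih a b.+1) ?orbT //; lia.
by rewrite ih //; lia.
Qed.

Lemma rank_one_order_top (F : numFieldType) d (e f : nat -> F) D :
  (forall a, (d < a)%N -> e a = 0) -> (forall a, (d < a)%N -> f a = 0) ->
  (forall a b, D 0%N a b = e a * f b) ->
  (forall j a b, D j.+1 a b = D j a.+1 b + D j a b.+1 + D j a.+1 b.+1) ->
  forall j a b, (j + a + b = d.*2)%N ->
  D j a b = (rank_one_coef d j a b)%:R * (e d * f d).
Proof.
move=> e0 f0 D0 DS; elim=> [|j ih] a b h /=.
  rewrite D0; have [|da|ea] := ltngtP a d; last 1 first.
  - rewrite ea; have -> : b = d by lia.
    by rewrite !eqxx /= mul1r.
  - by move=> ad; rewrite f0 ?mulr0 ?mul0r //; lia.
  - by rewrite e0 // !mul0r.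
rewrite DS (@rank_one_order_vanish F d.+1 e f D e0 f0 D0 DS j a.+1 b.+1); last by lia.
by rewrite addr0 !ih ?natrD ?mulrDl //; lia.
Qed.

(** * The adjoint on its cyclic vector w *)

Section Spectrum.
Context {R : realType}.
Variables (H : hilbertType R) (A T : {linear H -> H}) (w : H).
Hypothesis adjA : forall x y, hdot (A x) y = hdot x (T y).
Hypothesis TA : forall x, T (A x) = x + hdot x w *: w.
Notation C := (Cplx R).

Lemma adj_iter k x y : hdot (iter k A x) y = hdot x (iter k T y).
Proof. by elim: k y => //= k ih y; rewrite adjA ih -iterSr. Qed.

(** The k-th difference of T^k A^k x is T^k (T A - 1) A^k x, a multiple of
    T^k w. *)
Lemma beta_succE (adjE : adjoint A =1 T) m x :
  beta m.+1 A x = iter m fdiff (fun k => hdot x (iter k T w) *: iter k T w) 0.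
Proof.
have -> : beta m.+1 A x = iter m.+1 fdiff (fun k => iter k T (iter k A x)) 0.
  rewrite iter_fdiffE; apply: eq_bigr => k _; congr (_ *: _).
  exact: eq_iter.
rewrite iterSr; apply: eq_iter_fdiff => k; rewrite /fdiff iterSr [iter k.+1 A x]iterS TA.
rewrite [iter k T (_ + _)](_ : _ = iter k T (iter k A x) + hdot (iter k A x) w *: iter k T w).
  by rewrite addrAC subrr add0r adj_iter.
by elim: k (iter k A x) (hdot _ w) => //= k ih y a; rewrite ih linearD linearZ.
Qed.

Lemma strict_isometry_neq0 (adjE : adjoint A =1 T) n : (0 < n)%N ->
  strict_m_isometry (2 * n) A -> w != 0.
Proof.
move=> n0 [_ strict]; apply/eqP => w0; apply: strict => x.
have -> : (2 * n).-1 = (n.-1).*2.+1 by lia.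
rewrite (beta_succE adjE) iter_fdiffE big1 // => k _.
rewrite [iter k T w](_ : _ = 0) ?scaler0 //.
by rewrite w0; elim: (nat_of_ord k) => //= i ->; rewrite linear0.
Qed.

(** For |z| = 1 this is (X - z) / z, normalized so that T = z (1 + N) with
    N = jordan_poly z (T). *)
Definition jordan_poly (z : C) : {poly C} := z^* *: 'X - 1.

(** beta_(m+1) w = 0 is a polynomial relation between the T^k w, not trivial
    because its constant coefficient is a multiple of |w|^2. *)
Lemma exists_eigenvector (adjE : adjoint A =1 T) m : w != 0 -> m_isometry m.+1 A ->
  exists s z, opoly T s w != 0 /\ T (opoly T s w) = z *: opoly T s w.
Proof.
move=> w0 /(_ w); rewrite (beta_succE adjE) iter_fdiffE => h.
pose P := \poly_(k < m.+1) ((-1) ^+ (m - k) * 'C(m, k)%:R * hdot w (iter k T w)).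
have hP : opoly T P w = 0.
  rewrite (@opoly_wide _ _ _ _ m.+1) ?size_poly // -[RHS]h; apply: eq_bigr => k _.
  by rewrite coef_poly ltn_ord scalerA.
have P0 : P != 0.
  apply/eqP => /(congr1 (fun p : {poly C} => p`_0)); rewrite coef0 coef_poly /=.
  move/eqP; rewrite bin0 mulr1 mulf_eq0 hdotxx_eq0 (negPf w0) orbF.
  by rewrite expf_eq0 oppr_eq0 oner_eq0 andbF.
have [rs [c [c0 ers]]] : exists (rs : seq C) (c : C),
    c != 0 /\ P = c *: \prod_(z <- rs) ('X - z%:P).
  have [rs ers] := closed_field_poly_normal P.
  by exists rs, (lead_coef P); split; [rewrite lead_coef_eq0 | exact: ers].
apply: (@exists_eigen_factor _ _ T rs) => //.
move: hP; rewrite ers opolyZ => /eqP.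
by rewrite scaler_eq0 (negPf c0) => /eqP.
Qed.

Lemma opoly_jordan_poly_exp z m x : opoly T (jordan_poly z ^+ m) x =
  \sum_(k < m.+1) ((-1) ^+ (m - k) * 'C(m, k)%:R * z^* ^+ k) *: iter k T x.
Proof.
have -> : jordan_poly z ^+ m = \poly_(k < m.+1) ((-1) ^+ (m - k) * 'C(m, k)%:R * z^* ^+ k).
  rewrite /jordan_poly addrC exprDn poly_def; apply: eq_bigr => k _.
  rewrite exprZn -polyCN -polyC_exp mul_polyC scalerA -scaler_nat scalerA.
  by congr (_ *: _); ring.
rewrite (@opoly_wide _ _ _ _ m.+1) ?size_poly //; apply: eq_bigr => k _.
by rewrite coef_poly ltn_ord.
Qed.

(** Apply s(T) to the relation sum_k c_k <x, T^k w> T^k w = 0: as s(T) w is an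
    eigenvector u, it becomes a scalar multiple of u, so its coefficient
    vanishes for every x, and this is the polynomial identity for w.  Reading
    the latter on u gives |z|^2 = 1. *)
Lemma eigenvalue_nilpotent (adjE : adjoint A =1 T) m s z : m_isometry m.+2 A ->
  opoly T s w != 0 -> T (opoly T s w) = z *: opoly T s w ->
  z * z^* = 1 /\ opoly T (jordan_poly z ^+ m.+1) w = 0.
Proof.
set u := opoly T s w => isoA u0 Tu.
have iterTu k : iter k T u = z ^+ k *: u.
  by elim: k => [|k ih]; rewrite ?scale1r //= ih linearZ /= Tu scalerA exprSr.
have nu0 : opoly T (jordan_poly z ^+ m.+1) w = 0.
  apply: hdotl_eq0 => x; rewrite opoly_jordan_poly_exp.
  have := isoA x; rewrite (beta_succE adjE) iter_fdiffE => /(congr1 (opoly T s)).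
  rewrite opolyx0.
  under eq_bigr => k _ do rewrite scalerA.
  rewrite opoly_sum.
  under eq_bigr => k _ do rewrite opoly_iter -/u iterTu scalerA.
  rewrite -scaler_suml => /eqP; rewrite scaler_eq0 (negPf u0) orbF => /eqP h.
  rewrite hdot_sumr -[RHS]h; apply: eq_bigr => k _.
  rewrite hdotZr !rmorphM rmorphXn /= conjCK rmorphXn rmorphN rmorph1 rmorph_nat.
  by rewrite -!mulrA; congr (_ * (_ * _)); rewrite mulrC.
split => //; have : opoly T (jordan_poly z ^+ m.+1) u = 0.
  by rewrite /u -opolyM mulrC opolyM nu0 opolyx0.
rewrite (opoly_eigen _ Tu) => /eqP; rewrite scaler_eq0 (negPf u0) orbF.
rewrite horner_exp expf_eq0 /= /jordan_poly !hornerE subr_eq0 => /eqP <-.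
by rewrite mulrC.
Qed.

Section Order.
Variable z : C.
Hypothesis z1 : z * z^* = 1.

Definition jordan_vec a : H := opoly T (jordan_poly z ^+ a) w.

Lemma opoly_jordan_poly x : opoly T (jordan_poly z) x = z^* *: T x - x.
Proof. by rewrite opolyB opolyZ opolyX opolyC scale1r. Qed.

Lemma jordan_vecS a : jordan_vec a.+1 = z^* *: T (jordan_vec a) - jordan_vec a.
Proof. by rewrite /jordan_vec exprS opolyM opoly_jordan_poly. Qed.

Lemma T_jordan_vec a : T (jordan_vec a) = z *: (jordan_vec a + jordan_vec a.+1).
Proof. by rewrite jordan_vecS addrC subrK scalerA z1 scale1r. Qed.

Lemma jordan_vec_ge d a : jordan_vec d = 0 -> (d <= a)%N -> jordan_vec a = 0.
Proof.
by move=> h da; rewrite /jordan_vec -(subnK da) exprD opolyM -/(jordan_vec d) h opolyx0.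
Qed.

Definition rank_one_diff x v j a b : C :=
  iter j fdiff (fun k => hdot x (iter k T (jordan_vec a)) * hdot (iter k T (jordan_vec b)) v) 0.

Lemma rank_one_diffS x v j a b : rank_one_diff x v j.+1 a b =
  rank_one_diff x v j a.+1 b + rank_one_diff x v j a b.+1
  + rank_one_diff x v j a.+1 b.+1.
Proof.
have iterT k a' : iter k.+1 T (jordan_vec a') =
    z *: (iter k T (jordan_vec a') + iter k T (jordan_vec a'.+1)).
  elim: k => [|k ih]; first exact: T_jordan_vec.
  by rewrite [LHS]iterS [in LHS]ih [LHS]linearZ /= linearD.
rewrite /rank_one_diff -!iter_fdiffD iterSr; apply: eq_iter_fdiff => k.
rewrite /fdiff !iterT hdotZl hdotZr hdotDl hdotDr.
rewrite mulrACA (mulrC z^*) z1 mul1r; ring.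
Qed.

Lemma rank_one_diff_beta (adjE : adjoint A =1 T) m x v :
  hdot (beta m.+1 A x) v = rank_one_diff x v m 0 0.
Proof.
rewrite (beta_succE adjE).
rewrite (@morph_iter_fdiff _ _ (fun y => hdot y v)); last by move=> a b; rewrite hdotBl.
by apply: eq_iter_fdiff => k; rewrite hdotZl /jordan_vec expr0 opolyC scale1r.
Qed.

Lemma rank_one_diff00S m x v :
  rank_one_diff x v m.+1 0 0 = rank_one_diff (A x) (A v) m 0 0 - rank_one_diff x v m 0 0.
Proof.
rewrite {1}/rank_one_diff iterS /fdiff -/fdiff -iter_fdiff_shift.
congr (_ - _); apply: eq_iter_fdiff => k.
by rewrite adjA -iterS (hdotC _ (A v)) adjA -hdotC -iterS.
Qed.

(** Being an m-isometry is inherited by larger m. *)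
Lemma rank_one_diff00_vanish m r :
  (forall x v, rank_one_diff x v m 0 0 = 0) ->
  forall x v, rank_one_diff x v (r + m) 0 0 = 0.
Proof.
by move=> h; elim: r => //= r ih x v; rewrite addSn rank_one_diff00S !ih subrr.
Qed.

(** If the Jordan chain of w has length d + 1, the differences of w (x) w vanish
    from order 2d + 1 on and not at order 2d; strictness says that they vanish
    at order 2n - 1 and not at order 2n - 2. *)
Lemma strict_isometry_nilpotency (adjE : adjoint A =1 T) n : (0 < n)%N ->
  (exists d, jordan_vec d = 0) -> strict_m_isometry (2 * n) A ->
  jordan_vec n = 0 /\ jordan_vec n.-1 != 0.
Proof.
move=> n0 hd hs; have [iso2n strict] := hs.
have w0 := strict_isometry_neq0 adjE n0 hs.
have hd' : exists d, jordan_vec d == 0 by have [d /eqP] := hd; exists d.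
case: (ex_minnP hd') => -[|d] /eqP d0 dmin.
  by move: d0 w0; rewrite /jordan_vec opolyC scale1r => ->; rewrite eqxx.
have yd : jordan_vec d != 0.
  by apply/negP => /dmin; rewrite ltnn.
suff -> : n = d.+1 by split => //.
have top x v j a b := @rank_one_order_top _ d (fun a => hdot x (jordan_vec a))
  (fun a => hdot (jordan_vec a) v) (rank_one_diff x v) _ _ _ _ j a b.
have vanish x a : (d < a)%N -> hdot x (jordan_vec a) = 0.
  by move=> da; rewrite (jordan_vec_ge d0 da) hdot0r.
have vanish' v a : (d < a)%N -> hdot (jordan_vec a) v = 0.
  by move=> da; rewrite (jordan_vec_ge d0 da) hdot0l.
have le1 : (n.-1 <= d)%N.
  rewrite leqNgt; apply/negP => dn; apply: strict => x.
  have -> : (2 * n).-1 = (n.-1).*2.+1 by lia.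
  apply: hdotr_inj => v; rewrite hdot0l rank_one_diff_beta //.
  apply: (@rank_one_order_vanish _ d.+1 (fun a => hdot x (jordan_vec a))
    (fun a => hdot (jordan_vec a) v)) => //.
  - exact: vanish.
  - exact: vanish'.
  - exact: rank_one_diffS.
  - by lia.
suff le2 : (d <= n.-1)%N by lia.
rewrite leqNgt; apply/negP => nd.
have iso x v : rank_one_diff x v (n.-1).*2.+1 0 0 = 0.
  rewrite -rank_one_diff_beta // -[X in beta X](_ : (2 * n)%N = _); last by lia.
  by rewrite iso2n hdot0l.
have := rank_one_diff00_vanish (d.*2 - (n.-1).*2.+1) iso (jordan_vec d) (jordan_vec d).
rewrite subnK; last by lia.
(* Test at x = v = the last vector of the chain, where the surviving entry is
   a positive multiple of its squared norm. *)
rewrite top; last by lia.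
- move/eqP; rewrite !mulf_eq0 orbb hdotxx_eq0 (negPf yd) orbF pnatr_eq0.
  by apply/negP; rewrite -lt0n rank_one_coef_gt0 //; lia.
- exact: vanish.
- exact: vanish'.
- by [].
- exact: rank_one_diffS.
Qed.

End Order.

Lemma adjoint_unipotent (adjE : adjoint A =1 T) n : (0 < n)%N ->
  strict_m_isometry (2 * n) A ->
  exists z, [/\ z * z^* = 1, jordan_vec z n = 0 & jordan_vec z n.-1 != 0].
Proof.
move=> n0 hs; have [hiso _] := hs.
have e2n : (2 * n)%N = ((n.-1).*2).+2 by lia.
have w0 := strict_isometry_neq0 adjE n0 hs.
rewrite e2n in hiso.
have [s [z [u0 Tu]]] := exists_eigenvector adjE w0 hiso.
have [z1 nu0] := eigenvalue_nilpotent adjE hiso u0 Tu.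
exists z; have [] // := strict_isometry_nilpotency z1 adjE n0 _ hs.
by exists (n.-1).*2.+1.
Qed.

End Spectrum.

(** * The finite dimensional invariant subspace *)

Section CyclicSubspace.
Context {R : realType}.
Notation C := (Cplx R).

(** With x' the component of x orthogonal to V, membership in V + C x is
    membership in V of y minus its component along x', a Lipschitz function of
    y.  When x' = 0 the quotient by hdot x' x' is 0, and the formula still
    describes V + C x = V. *)
Lemma closed_subspace_add_line (H : hilbertType R) (V : set H) (x : H) :
  closed_subspace V -> closed_subspace [set y | exists c : C, V (y - c *: x)].
Proof.
move=> cV; have [Vc V0 _] := cV.
have [v Vv hv] := exists_projection x cV; have [x' ex'] : exists x', x' = x - v by exists (x - v).
rewrite -ex' in hv.
pose g (y : H) : H := y - (hdot y x' / hdot x' x') *: x'.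
have -> : [set y | exists c : C, V (y - c *: x)] = g @^-1` V.
  apply/seteqP; split => y /=.
    move=> [c Vy]; have [x0|x0] := eqVneq x' 0.
      rewrite /g x0 scaler0 subr0 -(subrK (c *: x) y); apply: closed_subspaceD => //.
      by apply: closed_subspaceZ => //; rewrite -(subrK v x) -ex' x0 add0r.
    have gs s t : V s -> g (s + t *: x') = s.
      move=> Vs; rewrite /g hdotDl hdotZl (hdotC s) hv // conjC0 add0r.
      by rewrite mulfK ?hdotxx_eq0 // addrK.
    have ey : y = (y - c *: x + c *: v) + c *: x'.
      by rewrite ex' scalerBr -addrA (addrC (c *: v)) subrK subrK.
    rewrite ey gs.
      by apply: closed_subspaceD => //; apply: closed_subspaceZ.
    by apply: closed_subspaceD => //; apply: closed_subspaceZ.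
  rewrite /g; set t := _ / _ => Vg; exists t.
  have -> : y - t *: x = (y - t *: x') - t *: v.
    by rewrite ex' scalerBr opprB addrA [RHS]addrAC addrK.
  by apply: closed_subspaceB => //; apply: closed_subspaceZ.
have gl (a : C) y1 y2 : g (a *: y1 + y2) = a *: g y1 + g y2.
  rewrite /g hdotDl hdotZl mulrDl scalerDl scalerBr scalerA mulrA opprD.
  by rewrite addrACA.
split.
- have gB y1 y2 : g y1 - g y2 = g (y1 - y2).
    by rewrite addrC -scaleN1r -gl scaleN1r addrC.
  apply: (@lipschitz_preimage_closed _ _ _ g (1 + `|x'| * `|(hdot x' x')^-1| * `|x'|)) => //.
  move=> y1 y2; rewrite gB; move: (y1 - y2) => {y1 y2} y.
  rewrite (le_trans (ler_normB _ _)) // normrZ normrM mulrDl mul1r lerD2l.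
  have -> : `|x'| * `|(hdot x' x')^-1| * `|x'| * `|y| =
    `|y| * `|x'| * `|(hdot x' x')^-1| * `|x'| by ring.
  by rewrite !ler_wpM2r // cauchy_schwarz.
- by rewrite /preimage /= /g hdot0l mul0r scale0r subr0.
- by move=> a y1 y2; rewrite /preimage /= gl => h1 h2; apply: closed_subspaceD => //; apply: closed_subspaceZ.
Qed.

Lemma closed_subspace_span (H : hilbertType R) (u : nat -> H) (k : nat) :
  closed_subspace [set x : H | exists c : nat -> C, x = \sum_(i < k) c i *: u i].
Proof.
elim: k => [|k ih].
  have -> : [set x : H | exists c : nat -> C, x = \sum_(i < 0) c i *: u i] = [set 0].
    apply/seteqP; split => x /=; first by move=> [c]; rewrite big_ord0.
    by move=> ->; exists (fun=> 0); rewrite big_ord0.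
  split => //; last by move=> a x y /= -> ->; rewrite scaler0 addr0.
  exact/accessible_closed_set1/hausdorff_accessible/norm_hausdorff.
have := closed_subspace_add_line (u k) ih.
congr closed_subspace; apply/seteqP; split => x /=.
  move=> [c [d e]]; exists (fun i => if i == k then c else d i).
  rewrite big_ord_recr /= eqxx -(subrK (c *: u k) x) e; congr (_ + _).
  by apply: eq_bigr => i _; rewrite ltn_eqF.
move=> [c ->]; exists (c k), c.
by rewrite big_ord_recr /= addrK.
Qed.

Definition cyclic_subspace (H : hilbertType R) (T : {linear H -> H}) (w : H) : set H :=
  [set x | exists p, x = opoly T p w].

Section Unipotent.
Variables (H : hilbertType R) (T : {linear H -> H}) (w : H) (z : C) (n : nat).
Hypothesis z1 : z * z^* = 1.
Hypothesis wn : jordan_vec T w z n = 0.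
Notation M := (cyclic_subspace T w).

Lemma eigenvalue_neq0 : z != 0.
Proof. by apply/eqP => h; move: z1; rewrite h mul0r => /esym/eqP; rewrite oner_eq0. Qed.

Lemma jordan_polyE : jordan_poly z = z^* *: ('X - z%:P).
Proof.
have e1 : z^* *: z%:P = 1 by rewrite -mul_polyC -polyCM mulrC z1.
by rewrite /jordan_poly scalerBr e1.
Qed.

Lemma size_jordan_poly_exp k : size (jordan_poly z ^+ k) = k.+1.
Proof.
by rewrite jordan_polyE exprZn size_scale ?size_exp_XsubC // expf_eq0 conjC_eq0 (negPf eigenvalue_neq0) andbF.
Qed.

Lemma cyclic_subspaceE :
  M = [set x | exists c : nat -> C, x = \sum_(i < n) c i *: iter i T w].
Proof.
apply/seteqP; split => x /=.
  move=> [p ->]; exists (fun i => (p %% jordan_poly z ^+ n)`_i).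
  rewrite {1}(divp_eq p (jordan_poly z ^+ n)) opolyD opolyM -/(jordan_vec T w z n) wn.
  rewrite opolyx0 add0r; apply: opoly_wide.
  rewrite -ltnS -(size_jordan_poly_exp n) ltn_modp -size_poly_eq0 size_jordan_poly_exp //.
move=> [c ->]; exists (\poly_(i < n) c i).
rewrite (@opoly_wide _ _ _ _ n) ?size_poly //; apply: eq_bigr => i _.
by rewrite coef_poly ltn_ord.
Qed.

Lemma closed_cyclic_subspace : closed_subspace M.
Proof. by rewrite cyclic_subspaceE; apply: closed_subspace_span. Qed.

Lemma cyclic_subspace_opoly p x : M x -> M (opoly T p x).
Proof. by move=> [q ->]; exists (p * q); rewrite opolyM. Qed.

Lemma cyclic_subspaceT x : M x -> M (T x).
Proof. by move=> Mx; rewrite -opolyX; apply: cyclic_subspace_opoly. Qed.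

Lemma cyclic_subspace_w : M w.
Proof. by exists 1; rewrite opolyC scale1r. Qed.

Lemma jordan_poly_cyclic x : M x -> opoly T (jordan_poly z ^+ n) x = 0.
Proof.
by move=> [p ->]; rewrite -opolyM mulrC opolyM -/(jordan_vec T w z n) wn opolyx0.
Qed.

Lemma jordan_poly_horner0 : (jordan_poly z ^+ n).[0] != 0.
Proof.
have nu0 : (jordan_poly z).[0] = -1 by rewrite /jordan_poly !hornerE; ring.
by rewrite horner_exp nu0 expf_eq0 oppr_eq0 oner_eq0 andbF.
Qed.

Lemma cyclic_inj x : M x -> T x = 0 -> x = 0.
Proof.
move=> Mx Tx; have := jordan_poly_cyclic Mx.
rewrite (@opoly_eigen _ _ _ _ _ 0) ?scale0r // => /eqP.
by rewrite scaler_eq0 (negPf jordan_poly_horner0) => /eqP.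
Qed.

(** T is invertible on M: modulo its annihilator there, X divides a nonzero
    constant. *)
Lemma cyclic_surj x : M x -> exists2 y, M y & T y = x.
Proof.
move=> Mx; set c := (jordan_poly z ^+ n).[0].
have /factor_theorem[q eq] : root (jordan_poly z ^+ n - c%:P) 0.
  by rewrite rootE hornerD hornerN hornerC subrr.
exists (- c^-1 *: opoly T q x).
  by apply: closed_subspaceZ; [exact: closed_cyclic_subspace | exact: cyclic_subspace_opoly].
have h : jordan_poly z ^+ n = q * 'X + c%:P by rewrite -(subrK c%:P (jordan_poly z ^+ n)) eq subr0.
have := jordan_poly_cyclic Mx; rewrite h opolyD opolyMX opolyC => /eqP.
rewrite addr_eq0 => /eqP Tq; rewrite linearZ /= Tq.
by rewrite scaleNr scalerN opprK scalerA mulVf ?scale1r // jordan_poly_horner0.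
Qed.

Lemma orthogonal_compl2_cyclic x : orthogonal_compl (orthogonal_compl M) x -> M x.
Proof. by move=> h; apply: closed_orthogonal_compl_sub h; apply: closed_cyclic_subspace. Qed.

Lemma invariant_span_cyclic (A : H -> H) : w != 0 -> adjoint A =1 T ->
  (forall x, defect A x = hdot x w *: w) ->
  invariant_span (adjoint A) (range (defect A)) = M.
Proof.
move=> w0 adjE defE; apply/seteqP; split => x.
  apply; split; first exact: closed_cyclic_subspace.
    by move=> y My; rewrite adjE; apply: cyclic_subspaceT.
  move=> _ [y _ <-]; rewrite defE; apply: closed_subspaceZ.
    exact: closed_cyclic_subspace.
  exact: cyclic_subspace_w.
move=> [p ->] V [cV Vinv Vran].
have Vw : V w.
  rewrite -[w](@scalerK _ _ (hdot w w)) ?hdotxx_eq0 // -defE.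
  by apply: closed_subspaceZ => //; apply: Vran; exists w.
elim/poly_ind: p => [|p c ih]; first by rewrite opoly0; case: cV.
rewrite opolyD opolyMX opolyC; apply: closed_subspaceD => //.
  by rewrite -adjE; apply: Vinv.
exact: closed_subspaceZ.
Qed.

End Unipotent.
End CyclicSubspace.

(** * Wandering vector and purity of the shift on the Hardy space *)

Section Hardy.
Context {R : realType}.
Notation C := (Cplx R).
Variables (E : discSpace R) (S : E -> E).
Hypothesis hE : is_hardy_space E.
Hypothesis hS : is_mult_z S.

Lemma hardy_coef_le (f : E) (a : nat -> C) k :
  series (fun n => `|a n| ^+ 2) @ \oo --> `|f| ^+ 2 -> `|a k| <= `|f|.
Proof.
move=> h; rewrite -(@ler_pXn2r _ 2) ?nnegrE //.
apply: (lim_ge_real (N := k.+1) _ h) => [|m km|m].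
- by rewrite rpredX ?normr_real.
- rewrite seriesEnat /= (bigD1_seq k) ?iota_uniq ?mem_index_iota //=.
  by rewrite lerDl sumr_ge0 // => i _; rewrite exprn_ge0.
- by rewrite seriesEnat /= rpred_sum // => i _; rewrite rpredX ?normr_real.
Qed.

Lemma hardy_eval_le (f : E) (z : C) : `|z| < 1 ->
  `|disc_eval f z| <= `|f| / (1 - `|z|).
Proof.
move=> z1; have [a [ta na]] := hE.1 f.
apply: (lim_norm_le (ta z z1)) => m; rewrite seriesEnat /= big_mkord.
rewrite (le_trans (ler_norm_sum _ _ _)) //.
apply: (@le_trans _ _ (\sum_(i < m) `|f| * `|z| ^+ i)).
  apply: ler_sum => i _; rewrite normrM normrX ler_wpM2r ?exprn_ge0 //.
  exact: hardy_coef_le na.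
by rewrite -mulr_sumr ler_wpM2l // geometric_sum_le.
Qed.

Lemma norm0_lt1 : `|0 : C| < 1. Proof. by rewrite normr0 ltr01. Qed.

Lemma disc_evalD (f g : E) z : `|z| < 1 -> disc_eval (f + g) z = disc_eval f z + disc_eval g z.
Proof. by move=> z1; rewrite -[f]scale1r disc_eval_linear // mul1r scale1r. Qed.

Lemma disc_eval0 z : `|z| < 1 -> disc_eval (0 : E) z = 0.
Proof. by move=> /(disc_evalD 0 0)/eqP; rewrite addr0 -subr_eq subrr => /eqP/esym. Qed.

Lemma disc_evalZ a (f : E) z : `|z| < 1 -> disc_eval (a *: f) z = a * disc_eval f z.
Proof. by move=> z1; rewrite -[a *: f]addr0 disc_eval_linear // disc_eval0 // addr0. Qed.

Lemma disc_eval_inj2 (f g : E) :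
  (forall z, `|z| < 1 -> disc_eval f z = disc_eval g z) -> f = g.
Proof.
move=> fg; apply/eqP; rewrite -subr_eq0; apply/eqP/disc_eval_inj => z z1.
by rewrite disc_evalD // -scaleN1r disc_evalZ // fg // mulN1r subrr.
Qed.

Lemma cvg_series_const0 (a : nat -> C) : series (fun n => a n * 0 ^+ n) @ \oo --> a 0%N.
Proof.
apply/cvg_distP => e e0; exists 1 => -[//|m _].
rewrite seriesEnat /= big_nat_recl // expr0 mulr1 big1 ?addr0 ?subrr ?normr0 // => i _.
by rewrite exprS mul0r mulr0.
Qed.

(** Shifting the Taylor coefficients divides by z. *)
Lemma hardy_div_z (f : E) : disc_eval f 0 = 0 -> exists g, f = S g.
Proof.
move=> f0; have [a [ta na]] := hE.1 f.
have a0 : a 0%N = 0.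
  rewrite -f0. apply: (lim_unique_dist (@cvg_series_const0 a)).
  by have /cvg_distP := ta 0 norm0_lt1.
have ser (u : nat -> C) m : u 0%N = 0 -> series (fun n => u n.+1) m = series u m.+1.
  by move=> u0; rewrite !seriesEnat /= [RHS]big_nat_recl // u0 add0r.
have [|g tg] := hE.2 (fun n => a n.+1).
  apply/cvg_ex; exists (`|f| ^+ 2); apply/cvg_distP => e e0.
  have [N hN] := (cvg_distP _ _).1 na e e0.
  exists N => m mN; rewrite (ser (fun n => `|a n| ^+ 2)) ?a0 ?normr0 ?expr0n //.
  by apply: hN; rewrite leqW.
exists g; apply: disc_eval_inj2 => z z1; rewrite hS //.
apply: (lim_unique_dist (ta z z1)) => e e0.
have [N hN] := (cvg_distP _ _).1 (tg z z1) e e0.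
exists N.+1 => -[//|m] mN.
rewrite -(ser (fun n => a n * z ^+ n)) ?a0 ?mul0r //.
have -> : series (fun n => a n.+1 * z ^+ n.+1) m = z * series (fun n => a n.+1 * z ^+ n) m.
  rewrite !seriesEnat /= big_distrr /=; apply: eq_bigr => i _.
  by rewrite exprS mulrCA.
rewrite -mulrBr normrM; apply: le_lt_trans (hN m mN).
by rewrite -[leRHS]mul1r ler_wpM2r // ltW.
Qed.

(** Evaluation at 0 is bounded, so it is represented by some u; by division, S E
    is its kernel, hence the orthogonal of u. *)
Lemma hardy_wandering : exists u : E, [/\ u != 0, forall g, hdot (S g) u = 0 &
  forall v, (forall g, hdot (S g) v = 0) -> exists a, v = a *: u].
Proof.
have [u hu] : exists u : E, forall f : E, disc_eval f 0 = hdot f u.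
  apply: (@riesz _ _ _ (1 - `|0 : C|)^-1) => [a x y|x].
    by rewrite disc_eval_linear // norm0_lt1.
  by rewrite mulrC hardy_eval_le // norm0_lt1.
have u0 : u != 0.
  apply/eqP => u0.
  have [|f tf] := hE.2 (fun n => (n == 0%N)%:R).
    apply/cvg_ex; exists 1; apply/cvg_distP => e e0; exists 1 => -[//|m _].
    rewrite seriesEnat /= big_nat_recl //= normr1 expr1n big1 => [|i _].
      by rewrite addr0 subrr normr0.
    by rewrite normr0 expr0n.
  have := lim_unique_dist (tf 0 norm0_lt1) ((cvg_distP _ _).1 (@cvg_series_const0 _)).
  by rewrite hu u0 hdot0r => /esym/eqP; rewrite oner_eq0.
have Su g : hdot (S g) u = 0 by rewrite -hu hS ?norm0_lt1 // mul0r.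
exists u; split => // v hv.
exists (disc_eval v 0 / hdot u u); set a := _ / _.
have [g eg] : exists g, v - a *: u = S g.
  apply: hardy_div_z; rewrite disc_evalD ?norm0_lt1 // -scaleNr disc_evalZ ?norm0_lt1 //.
  by rewrite [disc_eval u 0]hu /a mulNr divfK ?hdotxx_eq0 // subrr.
apply/eqP; rewrite -subr_eq0 -hdotxx_eq0 {1}eg hdotBr hdotZr hv Su mulr0 subr0.
by [].
Qed.

(** f 0 at z is z^j times f j at z, and evaluation at z is bounded uniformly
    along the orbit. *)
Lemma hardy_pure (f : nat -> E) : (forall j, `|f j| = `|f 0%N|) ->
  (forall j, f j = S (f j.+1)) -> f 0%N = 0.
Proof.
move=> fn fS; apply: disc_eval_inj => z z1.
have ev j : disc_eval (f 0%N) z = z ^+ j * disc_eval (f j) z.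
  elim: j => [|j ->]; first by rewrite mul1r.
  by rewrite [in LHS]fS hS // exprSr mulrA.
set B := `|f 0%N| / (1 - `|z|).
have B0 : 0 <= B by rewrite divr_ge0 // subr_ge0 ltW.
apply/eqP; rewrite -normr_le0; apply/ler_addgt0Pr => e e0; rewrite add0r.
have B1 : 0 < B + 1 by rewrite ltr_wpDl.
have [N /(_ N (leqnn N)) hN] := expr_small (normr_ge0 z) z1 (divr_gt0 e0 B1).
rewrite (ev N) normrM normrX; apply: (@le_trans _ _ (`|z| ^+ N * (B + 1))).
  rewrite ler_wpM2l ?exprn_ge0 // (le_trans (hardy_eval_le _ z1)) // fn -/B.
  by rewrite lerDl.
by rewrite -ler_pdivlMr // ltW.
Qed.

End Hardy.

(** * The kernel of the adjoint *)

Section WanderingKernel.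
Context {R : realType}.
Notation C := (Cplx R).
Variables (H : hilbertType R) (A T : {linear H -> H}) (w : H) (z : C) (n : nat).
Hypothesis adjA : forall x y, hdot (A x) y = hdot x (T y).
Hypothesis TA : forall x, T (A x) = x + hdot x w *: w.
Hypothesis z1 : z * z^* = 1.
Hypothesis wn : jordan_vec T w z n = 0.
Notation M := (cyclic_subspace T w).
Notation N := (orthogonal_compl (cyclic_subspace T w)).

Lemma hdotAA x y : hdot (A x) (A y) = hdot x y + hdot x w * hdot w y.
Proof. by rewrite adjA TA hdotDr hdotZr -hdotC mulrC. Qed.

Lemma orthogonal_compl_cyclicA x : N x -> N (A x).
Proof. by move=> Nx y My; rewrite adjA Nx //; apply: cyclic_subspaceT. Qed.

Lemma orthogonal_compl_cyclicw x : N x -> hdot x w = 0.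
Proof. by move=> h; apply: h; apply: cyclic_subspace_w. Qed.

Lemma norm_orthogonal_compl_cyclic x : N x -> `|A x| = `|x|.
Proof.
move=> Nx; apply/eqP; rewrite -(@eqrXn2 _ 2) // !hilbert_normE hdotAA.
by rewrite orthogonal_compl_cyclicw // mul0r addr0.
Qed.

Variables (E : discSpace R) (S : E -> E) (U : {linear E -> H}).
Hypothesis hE : is_hardy_space E.
Hypothesis hS : is_mult_z S.
Hypothesis UI : forall x y, hdot (U x) (U y) = hdot x y.
Hypothesis rU : range U = N.
Hypothesis US : forall x, U (S x) = A (U x).

Lemma hardy_normU x : `|U x| = `|x|.
Proof. by apply/eqP; rewrite -(@eqrXn2 _ 2) // !hilbert_normE UI. Qed.

Lemma orthogonal_compl_pure (f : nat -> H) :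
  (forall j, N (f j)) -> (forall j, f j = A (f j.+1)) -> f 0%N = 0.
Proof.
move=> Nf fA.
have /choice[g Ug] j : exists g, U g = f j.
  by have := Nf j; rewrite -rU => -[g _ <-]; exists g.
have gS j : g j = S (g j.+1).
  apply/eqP; rewrite -subr_eq0 -normr_le0 -hardy_normU linearB US !Ug -fA.
  by rewrite subrr normr0.
have gn j : `|g j| = `|g 0%N|.
  elim: j => // j <-; rewrite -!hardy_normU !Ug (fA j).
  by rewrite norm_orthogonal_compl_cyclic.
by rewrite -Ug (hardy_pure hE hS gn gS) linear0.
Qed.

(** The wandering vector u of the shift on N is orthogonal to A N, so T u lies
    in M; as T is bijective on M, exactly one m in M corrects u to an element
    u - m of ker T.  Conversely the N-component of an element of ker T is
    orthogonal to A N, hence a multiple of u. *)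
Lemma kernel_adjoint_line : exists e : H, [/\ hdot e e = 1, T e = 0 &
  forall x, T x = 0 -> exists a, x = a *: e].
Proof.
have [u' [u'0 Su' spanu']] := hardy_wandering hE hS.
pose u := U u'.
have Nu : N u by rewrite -rU; exists u'.
have u0 : u != 0 by rewrite -normr_eq0 hardy_normU normr_eq0.
have Au x : N x -> hdot (A x) u = 0.
  by rewrite -rU => -[g _ <-]; rewrite -US UI Su'.
have uspan v : N v -> (forall x, N x -> hdot (A x) v = 0) -> exists a, v = a *: u.
  rewrite -{1}rU => -[v' _ <-] hv; have [|a ->] := spanu' v'.
    by move=> g; rewrite -UI US hv // -rU; exists g.
  by exists a; rewrite linearZ.
have MTu : M (T u).
  apply: (orthogonal_compl2_cyclic z1 wn) => x Nx.
  by rewrite hdotC -adjA Au // conjC0.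
have [m Mm Tm] := cyclic_surj z1 wn MTu.
pose e0 := u - m.
have e0N : e0 != 0.
  rewrite subr_eq0; apply/eqP => um; move: u0.
  by rewrite -hdotxx_eq0 Nu ?eqxx // um.
have Te0 : T e0 = 0 by rewrite /e0 linearB Tm subrr.
have uniq x : T x = 0 -> exists a, x = a *: e0.
  move=> Tx; have cM := closed_cyclic_subspace z1 wn.
  have [m' Mm' Nm'] := exists_projection x cM.
  have [||a ea] := uspan (x - m').
  - exact: Nm'.
  - move=> y Ny; rewrite hdotBr !adjA Tx hdot0r Ny ?subrr //.
    exact: cyclic_subspaceT.
  exists a; apply/eqP; rewrite -subr_eq0; apply/eqP.
  apply: (cyclic_inj wn); last by rewrite linearB linearZ /= Tx Te0 scaler0 subrr.
  have -> : x - a *: e0 = m' + a *: m.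
    rewrite /e0 scalerBr -ea opprB addrA addrAC.
    by rewrite opprB [x + _]addrC subrK addrC.
  by apply: closed_subspaceD => //; apply: closed_subspaceZ.
exists (`|e0|^-1 *: e0); split.
- rewrite hdotZl hdotZr -hilbert_normE fmorphV /= (CrealP _) ?normr_real //.
  by field; rewrite normr_eq0.
- by rewrite linearZ /= Te0 scaler0.
- move=> x /uniq[a ->]; exists (a * `|e0|); rewrite scalerA mulfK ?normr_eq0 //.
Qed.

End WanderingKernel.

(** * The functional model: reproducing vectors *)

Section Model.
Context {R : realType}.
Notation C := (Cplx R).
Variables (H : hilbertType R) (A T : {linear H -> H}) (w : H).
Hypothesis adjA : forall x y, hdot (A x) y = hdot x (T y).
Hypothesis TA : forall x, T (A x) = x + hdot x w *: w.

Definition defect_weight : C := (1 + hdot w w)^-1.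
Local Notation c := defect_weight.

Lemma defect_weight_gt0 : 0 < c.
Proof. by rewrite invr_gt0 ltr_wpDr ?hdotxx_ge0. Qed.

Lemma defect_weight_conj : c^* = c.
Proof. by apply/CrealP; rewrite gtr0_real // defect_weight_gt0. Qed.

Lemma defect_weightE : c * hdot w w = 1 - c.
Proof.
have : c * (1 + hdot w w) = 1 by rewrite mulVf // gt_eqF // ltr_wpDr ?hdotxx_ge0.
by rewrite mulrDr mulr1 => <-; rewrite addrAC subrr add0r.
Qed.

(** The inverse of T A = 1 + w (x) w. *)
Definition gram_inv (x : H) : H := x - (c * hdot x w) *: w.

Lemma gram_inv_linear a x y : gram_inv (a *: x + y) = a *: gram_inv x + gram_inv y.
Proof.
rewrite /gram_inv hdotDl hdotZl mulrDr scalerDl scalerBr scalerA mulrCA opprD.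
by rewrite addrACA.
Qed.

Lemma hdot_gram_inv x y : hdot (gram_inv x) y = hdot x y - c * hdot x w * hdot w y.
Proof. by rewrite /gram_inv hdotBl hdotZl. Qed.

Lemma gram_inv_sym x y : hdot (gram_inv x) y = hdot x (gram_inv y).
Proof.
rewrite hdot_gram_inv /gram_inv hdotBr hdotZr rmorphM /= defect_weight_conj -hdotC.
by ring.
Qed.

Lemma gram_invK x : gram_inv (x + hdot x w *: w) = x.
Proof.
rewrite /gram_inv hdotDl hdotZl mulrDr mulrCA defect_weightE scalerDl mulrBr mulr1.
rewrite -addrA -scalerDl -scalerBl.
by rewrite [X in X *: w](_ : _ = 0) ?scale0r ?addr0 //; ring.
Qed.

Lemma gram_invKV x : gram_inv x + hdot (gram_inv x) w *: w = x.
Proof.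
rewrite hdot_gram_inv mulrAC defect_weightE /gram_inv -addrA -scaleNr -scalerDl.
by rewrite [X in X *: w](_ : _ = 0) ?scale0r ?addr0 //; ring.
Qed.

Variable L : {linear H -> H}.
Hypothesis LE : forall x, L x = gram_inv (T x).

(** The Cauchy dual A (T A)^-1, which is the adjoint of the left inverse L. *)
Definition cauchy_dual (x : H) : H := A (gram_inv x).

Lemma cauchy_dualB x y : cauchy_dual (x - y) = cauchy_dual x - cauchy_dual y.
Proof.
by rewrite addrC -scaleN1r /cauchy_dual gram_inv_linear linearP scaleN1r addrC.
Qed.

Lemma cauchy_dual0 : cauchy_dual 0 = 0.
Proof. by rewrite -(subrr 0) cauchy_dualB !subrr. Qed.

Local Notation A' := cauchy_dual.

Lemma left_invK x : L (A x) = x.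
Proof. by rewrite LE TA gram_invK. Qed.

Lemma hdot_cauchy_dual x y : hdot (A' x) y = hdot x (L y).
Proof. by rewrite /cauchy_dual adjA LE gram_inv_sym. Qed.

Lemma hdot_cauchy_dual2 x y : hdot (A' x) (A' y) = hdot x y - c * hdot x w * hdot w y.
Proof.
rewrite /cauchy_dual adjA TA gram_invKV hdot_gram_inv //.
Qed.

Lemma norm_cauchy_dual_le x : `|A' x| <= `|x|.
Proof.
rewrite -(@ler_pXn2r _ 2) ?nnegrE // !hilbert_normE hdot_cauchy_dual2 gerBl.
by rewrite -mulrA mulr_ge0 ?(ltW defect_weight_gt0) // (hdotC w x) -normCK exprn_ge0.
Qed.

Variable e : H.
Hypothesis e1 : hdot e e = 1.
Hypothesis Te : T e = 0.
Hypothesis kerT : forall x, T x = 0 -> exists a, x = a *: e.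

Lemma hdotAe x : hdot (A x) e = 0.
Proof. by rewrite adjA Te hdot0r. Qed.

Lemma norm_e : `|e| = 1.
Proof. by apply/eqP; rewrite -(@eqrXn2 _ 2) // hilbert_normE e1 expr1n. Qed.

Lemma left_inv_decomp f : f = A (L f) + hdot f e *: e.
Proof.
have [|a ea] := kerT (x := f - A (L f)).
  by rewrite linearB TA LE gram_invKV subrr.
have fa : hdot f e = a.
  have -> : f = a *: e + A (L f) by rewrite -ea subrK.
  by rewrite hdotDl hdotZl e1 hdotAe addr0 mulr1.
by rewrite fa -ea addrC subrK.
Qed.

(** Neumann series for a strict contraction: the iterates s of x |-> e + B x are
    bounded by 1 / (1 - r), so s (k + m) and s k differ by at most
    r^k / (1 - r). *)
Lemma exists_kernel_vec (l : C) : `|l| < 1 -> exists k, k = e + l^* *: A' k.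
Proof.
move=> l1; set r := `|l| in l1.
have r0 : 0 <= r by exact: normr_ge0.
have r1 : 0 < 1 - r by rewrite subr_gt0.
pose B (x : H) : H := l^* *: A' x.
have BB x y : `|B x - B y| <= r * `|x - y|.
  rewrite /B -scalerBr -cauchy_dualB normrZ norm_conjC -/r ler_wpM2l //.
  exact: norm_cauchy_dual_le.
pose s m := iter m (fun x => e + B x) 0.
have sB m : s m.+1 = e + B (s m) by [].
have s_le m : `|s m| <= (1 - r)^-1.
  elim: m => [|m ih]; first by rewrite normr0 invr_ge0 ltW.
  rewrite sB (le_trans (ler_normD _ _)) // norm_e.
  have := BB (s m) 0; rewrite {2}/B cauchy_dual0 scaler0 !subr0 => h.
  have -> : (1 - r)^-1 = 1 + r * (1 - r)^-1 by field; rewrite gt_eqF.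
  by rewrite lerD2l (le_trans h) // ler_wpM2l.
have s_dist k m : `|s (k + m)%N - s k| <= r ^+ k * (1 - r)^-1.
  elim: k => [|k ih]; first by rewrite expr0 mul1r subr0.
  rewrite addSn !sB opprD addrACA subrr add0r (le_trans (BB _ _)) // exprS -mulrA.
  by rewrite ler_wpM2l.
have [k sk] : exists k : H, s @ \oo --> k.
  apply: cauchy_dist_cvg => eps eps0.
  have eps2 : 0 < eps / 2 * (1 - r) by rewrite mulr_gt0 ?divr_gt0.
  have [N hN] := expr_small r0 (ltac:(by rewrite -subr_gt0) : r < 1) eps2.
  have close m : (N <= m)%N -> `|s m - s N| < eps / 2.
    move=> /subnKC <-; rewrite (le_lt_trans (s_dist _ _)) //.
    by rewrite ltr_pdivrMr // hN.
  exists N => m m' Nm Nm'.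
  have -> : s m - s m' = (s m - s N) - (s m' - s N) by rewrite opprB addrA subrK.
  by rewrite (le_lt_trans (ler_normB _ _)) // (splitr eps) ltrD // close.
exists k; apply: (lim_unique_dist sk) => eps eps0.
have [N hN] := (cvg_distP _ _).1 sk eps eps0.
exists N.+1 => -[//|m] Nm; rewrite sB -/(B k) opprD addrACA subrr add0r.
rewrite (le_lt_trans (BB _ _)) // (le_lt_trans _ (hN m Nm)) //.
by rewrite -[leRHS]mul1r ler_wpM2r // ltW // -subr_gt0.
Qed.

Definition kernel_vec (l : C) : H := xget 0 [set k | k = e + l^* *: A' k].
Local Notation k_ := kernel_vec.

Lemma kernel_vecE l : `|l| < 1 -> k_ l = e + l^* *: A' (k_ l).
Proof.
by move=> /exists_kernel_vec[k hk]; rewrite /kernel_vec; case: xgetP => [x _ //|/(_ k)/(_ hk)].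
Qed.

Lemma kernel_vec0 : k_ 0 = e.
Proof. by rewrite kernel_vecE ?normr0 // conjC0 scale0r addr0. Qed.

Lemma hdot_kernel_rec f l : `|l| < 1 ->
  hdot f (k_ l) = hdot f e + l * hdot (L f) (k_ l).
Proof.
move=> l1; rewrite {1}kernel_vecE // hdotDr hdotZr conjCK; congr (_ + _ * _).
by rewrite hdotC hdot_cauchy_dual -hdotC.
Qed.

Lemma hdot_A_kernel f l : `|l| < 1 -> hdot (A f) (k_ l) = l * hdot f (k_ l).
Proof. by move=> l1; rewrite hdot_kernel_rec // hdotAe add0r left_invK. Qed.

(** Expand both vectors by [kernel_vecE]: e has norm 1 and is orthogonal to the
    range of A, and the Cauchy dual preserves inner products up to the rank one
    term of [gram_inv]. *)
Lemma hdot_kernel2 l l' : `|l| < 1 -> `|l'| < 1 ->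
  hdot (k_ l) (k_ l') * (1 - l^* * l') =
  1 - c * l^* * l' * hdot (k_ l) w * hdot w (k_ l').
Proof.
move=> h h'; have : hdot (k_ l) (k_ l') =
    1 + l^* * l' * (hdot (k_ l) (k_ l') - c * hdot (k_ l) w * hdot w (k_ l')).
  rewrite {1}(kernel_vecE h) {1}(kernel_vecE h') hdotDl !hdotDr !hdotZl !hdotZr e1.
  rewrite hdotAe hdot_cauchy_dual2 (hdotC e) hdotAe conjC0 conjCK; ring.
move=> E; rewrite mulrBr mulr1 {1}E; ring.
Qed.

Lemma norm_kernel_vec l : `|l| < 1 -> `|k_ l| <= (1 - `|l|)^-1.
Proof.
move=> l1; have r1 : 0 < 1 - `|l| by rewrite subr_gt0.
rewrite -[leRHS]mul1r ler_pdivlMr // mulrBr mulr1 lerBlDr {1}kernel_vecE //.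
rewrite (le_trans (ler_normD _ _)) // norm_e lerD2l normrZ norm_conjC mulrC.
by rewrite ler_wpM2r // norm_cauchy_dual_le.
Qed.

(** The transform of L f is that of f divided by l; at l = 0 its value
    <L f, e> is the limit along l = 1 / (m + 2), where the kernel vectors are
    bounded by 2. *)
Lemma kernel_transform_left_inv f :
  (forall l, `|l| < 1 -> hdot f (k_ l) = 0) ->
  forall l, `|l| < 1 -> hdot (L f) (k_ l) = 0.
Proof.
move=> hf.
have fe : hdot f e = 0 by rewrite -kernel_vec0 hf // normr0.
have nz l : l != 0 -> `|l| < 1 -> hdot (L f) (k_ l) = 0.
  move=> l0 l1; have := hf l l1; rewrite hdot_kernel_rec // fe add0r => /eqP.
  by rewrite mulf_eq0 (negPf l0) => /eqP.
move=> l l1; have [->|] := eqVneq l 0; last by move=> l0; exact: nz.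
rewrite kernel_vec0; apply/eqP; rewrite -normr_le0.
apply/ler_addgt0Pr => eps eps0; rewrite add0r.
pose K := `|L (L f)| * 2 + 1.
have K0 : 0 < K by rewrite ltr_wpDl // mulr_ge0.
have [m /(_ m (leqnn m)) hm] := natSinv_lt (divr_gt0 eps0 K0).
pose r : C := m.+2%:R^-1.
have r0 : 0 < r by rewrite invr_gt0.
have nr : `|r| = r by rewrite gtr0_norm.
have r2 : r <= 2^-1 by rewrite lef_pV2 ?posrE // ler_nat.
have r1 : `|r| < 1 by rewrite nr (le_lt_trans r2) // invf_lt1 // ltr1n.
have := nz r (lt0r_neq0 r0) r1; rewrite hdot_kernel_rec // => /eqP.
rewrite addr_eq0 => /eqP ->; rewrite normrN normrM nr.
have hk : `|hdot (L (L f)) (k_ r)| <= K.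
  rewrite (le_trans (cauchy_schwarz _ _)) // /K.
  rewrite (@le_trans _ _ (`|L (L f)| * 2)) ?lerDl // ler_wpM2l //.
  rewrite (le_trans (norm_kernel_vec r1)) // nr.
  have r12 : 2^-1 <= 1 - r.
    have {1}-> : 2^-1 = 1 - 2^-1 :> C by field.
    by rewrite lerD2l lerN2.
  rewrite -[leRHS]invrK lef_pV2 ?posrE ?invr_gt0 //.
  by apply: lt_le_trans r12; rewrite invr_gt0.
apply: (@le_trans _ _ (r * K)); first by rewrite ler_wpM2l // ltW.
rewrite -ler_pdivlMr // (le_trans _ (ltW hm)) //.
by rewrite lef_pV2 ?posrE // ler_nat.
Qed.

Lemma kernel_transform_coef f :
  (forall l, `|l| < 1 -> hdot f (k_ l) = 0) -> forall j, hdot (iter j L f) e = 0.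
Proof.
move=> hf j; elim: j f hf => [|j ih] f hf /=.
  by rewrite -kernel_vec0 hf // normr0.
by rewrite -iterS iterSr; apply/ih/kernel_transform_left_inv.
Qed.

End Model.

(** * Backward orbits and injectivity of the model *)

Section Observability.
Context {R : realType}.
Notation C := (Cplx R).

Definition square_summable (t : nat -> C) :=
  exists B, forall m, \sum_(j < m) `|t j| ^+ 2 <= B.

Lemma square_summable_shift t : square_summable t -> square_summable (fun j => t j.+1).
Proof.
move=> [B hB]; exists B => m; apply: le_trans (hB m.+1).
by rewrite big_ord_recl lerDr exprn_ge0.
Qed.

Lemma square_summableB (a : C) s t : square_summable s -> square_summable t ->
  square_summable (fun j => a * s j - t j).
Proof.
move=> [B hB] [D hD]; exists (2 * `|a| ^+ 2 * B + 2 * D) => m.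
apply: (@le_trans _ _ (\sum_(j < m) (2 * `|a| ^+ 2 * `|s j| ^+ 2 + 2 * `|t j| ^+ 2))).
  apply: ler_sum => j _.
  have h : `|a * s j - t j| ^+ 2 <= (`|a| * `|s j| + `|t j|) ^+ 2.
    by rewrite ler_pXn2r ?nnegrE ?addr_ge0 ?mulr_ge0 // (le_trans (ler_normB _ _)) // normrM.
  apply: (le_trans h); rewrite -subr_ge0.
  have -> : 2 * `|a| ^+ 2 * `|s j| ^+ 2 + 2 * `|t j| ^+ 2 - (`|a| * `|s j| + `|t j|) ^+ 2
     = (`|a| * `|s j| - `|t j|) ^+ 2 by ring.
  by rewrite real_exprn_even_ge0 // rpredB ?rpredM ?normr_real.
rewrite big_split -!mulr_sumr lerD // ler_wpM2l // mulr_ge0 ?exprn_ge0 //.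
Qed.

Lemma square_summable_const0 t : square_summable t ->
  (forall j, `|t j.+1| = `|t j|) -> forall j, t j = 0.
Proof.
move=> [B hB] tc.
have tE j : `|t j| = `|t 0%N| by elim: j => // j <-.
have t0 : `|t 0%N| ^+ 2 <= 0.
  apply/ler_addgt0Pr => e e0; rewrite add0r.
  have B0 : 0 <= B by have := hB 0%N; rewrite big_ord0.
  have B1 : 0 < B + 1 by rewrite ltr_wpDl.
  have [m /(_ m (leqnn m)) /ltW hm] := natSinv_lt (divr_gt0 e0 B1).
  have := hB m.+1; rewrite (eq_bigr (fun=> `|t 0%N| ^+ 2)) => [|i _]; last by rewrite tE.
  rewrite sumr_const card_ord -mulr_natr => h.
  have h2 : `|t 0%N| ^+ 2 * m.+1%:R <= B + 1 by rewrite (le_trans h) // lerDl.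
  rewrite -ler_pdivlMr // in h2; apply: (le_trans h2).
  by rewrite mulrC -ler_pdivlMr.
move=> j; apply/eqP; rewrite -normr_eq0 tE -sqrf_eq0 eq_le t0 exprn_ge0 //.
Qed.

Variables (H : hilbertType R) (A T : {linear H -> H}) (w : H) (z : C) (n : nat).
Hypothesis adjA : forall x y, hdot (A x) y = hdot x (T y).
Hypothesis TA : forall x, T (A x) = x + hdot x w *: w.
Hypothesis z1 : z * z^* = 1.
Hypothesis wn : jordan_vec T w z n = 0.
Notation M := (cyclic_subspace T w).
Notation N := (orthogonal_compl (cyclic_subspace T w)).
Hypothesis pure : forall f : nat -> H,
  (forall j, N (f j)) -> (forall j, f j = A (f j.+1)) -> f 0%N = 0.

(** By the defect identity |f j|^2 = |f (j+1)|^2 + |<f (j+1), w>|^2, the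
    sequence <f j, w> is square summable.  Pairing the orbit with the Jordan
    chain of w gives sequences t i, each a combination of two consecutive terms
    of the preceding one, and t n = 0; if t (i+1) = 0, then t i has constant
    modulus, so it is 0 by summability.  Down at i = 0, the orbit is orthogonal
    to w, hence to M, and purity on N applies. *)
Lemma backward_orbit0 (f : nat -> H) : (forall j, f j = A (f j.+1)) -> f 0%N = 0.
Proof.
move=> fA.
have nf j : `|f j| ^+ 2 = `|f j.+1| ^+ 2 + `|hdot (f j.+1) w| ^+ 2.
  rewrite !hilbert_normE {1 2}(fA j) (hdotAA adjA TA) normCK; congr (_ + _ * _).
  exact: hdotC.
have sum_f m : \sum_(j < m) `|hdot (f j.+1) w| ^+ 2 = `|f 0%N| ^+ 2 - `|f m| ^+ 2.
  elim: m => [|m ih]; first by rewrite big_ord0 subrr.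
  by rewrite big_ord_recr /= ih (nf m); ring.
pose t i j := hdot (f (j + i)%N) (jordan_vec T w z i).
have tS i j : t i.+1 j = z * t i j - t i j.+1.
  rewrite /t (jordan_vecS T w) hdotBr hdotZr conjCK -adjA addnS -fA.
  by rewrite addSn.
have t_sum i : square_summable (t i).
  elim: i => [|i ih].
    exists (`|hdot (f 0%N) w| ^+ 2 + `|f 0%N| ^+ 2) => m.
    have t0 j : t 0%N j = hdot (f j) w.
      by rewrite /t addn0 /jordan_vec expr0 opolyC scale1r.
    case: m => [|m]; first by rewrite big_ord0 addr_ge0 ?exprn_ge0.
    rewrite big_ord_recl t0 lerD2l (eq_bigr (fun j : 'I_m => `|hdot (f j.+1) w| ^+ 2)).
      by rewrite sum_f gerBl exprn_ge0.
    by move=> j _; rewrite t0 lift0.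
  have := square_summableB z ih (square_summable_shift ih).
  by case=> B hB; exists B => m; under eq_bigr do rewrite tS; exact: hB.
have t0 i : (i <= n)%N -> forall j, t (n - i)%N j = 0.
  elim: i => [_ j|i ih ni]; first by rewrite subn0 /t wn hdot0r.
  apply: square_summable_const0 => // j.
  have := ih (ltnW ni) j; rewrite -(subnSK ni) tS => /eqP.
  rewrite subr_eq0 => /eqP <-; rewrite normrM.
  have -> : `|z| = 1.
    by apply/eqP; rewrite -(@eqrXn2 _ 2) // normCK z1 expr1n.
  by rewrite mul1r.
have fw j : hdot (f j) w = 0.
  by have := t0 n (leqnn n) j; rewrite subnn /t addn0 /jordan_vec expr0 opolyC scale1r.
have f_iter k j : f j = iter k A (f (j + k)%N).
  by elim: k => [|k ih]; rewrite ?addn0 // addnS iterSr -fA.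
(* <f (j + n), T^i w> = <f (j + n - i), w> needs n more steps backward; these
   are then undone because A maps N to itself. *)
have Nf_far j : N (f (j + n)%N).
  rewrite (cyclic_subspaceE z1 wn) => _ [d ->].
  rewrite hdot_sumr big1 // => i _; rewrite hdotZr -(adj_iter adjA).
  have -> : (j + n = j + (n - i) + i)%N by rewrite -addnA subnK // ltnW.
  by rewrite -f_iter fw mulr0.
apply: pure => // j; rewrite (f_iter n j).
elim: {1}n => [|k ih]; first exact: Nf_far.
exact: (orthogonal_compl_cyclicA adjA ih).
Qed.

End Observability.

(** * Rationality of the symbol *)

Section Symbol.
Context {R : realType}.
Notation C := (Cplx R).
Variables (H : hilbertType R) (A T L : {linear H -> H}) (w e : H) (z : C) (n : nat).
Hypothesis adjA : forall x y, hdot (A x) y = hdot x (T y).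
Hypothesis TA : forall x, T (A x) = x + hdot x w *: w.
Hypothesis LE : forall x, L x = gram_inv w (T x).
Hypothesis e1 : hdot e e = 1.
Hypothesis Te : T e = 0.
Hypothesis z1 : z * z^* = 1.
Hypothesis n0 : (0 < n)%N.
Hypothesis wn : jordan_vec T w z n = 0.
Hypothesis wn1 : jordan_vec T w z n.-1 != 0.
Hypothesis obs : forall f, (forall j, hdot (iter j L f) e = 0) -> f = 0.
Local Notation k_ := (kernel_vec A w e).

(** Write p = q (X - z)^m with q z <> 0 and multiply up to (X - z)^(n-1): this
    sends w to an eigenvector for z, on which q(T) acts as q z. *)
Lemma opoly_cyclic_neq0 (p : {poly C}) : p != 0 -> (size p <= n)%N -> opoly T p w != 0.
Proof.
move=> p0 sp; apply/eqP => pw.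
have [m [q]] := multiplicity_XsubC p z; rewrite p0 /= => qz ep.
have q0 : q != 0 by apply: contraNneq qz => ->; rewrite root0.
have mn : (m < n)%N.
  move: sp; rewrite ep size_Mmonic ?monic_exp ?monicXsubC // size_exp_XsubC addnS /=.
  by apply: leq_trans; rewrite -add1n leq_add2r size_poly_gt0.
have XE : 'X - z%:P = z *: jordan_poly z by rewrite (jordan_polyE z1) scalerA z1 scale1r.
have : opoly T (jordan_poly z ^+ (n.-1 - m) * p) w = 0 by rewrite opolyM pw opolyx0.
have -> : jordan_poly z ^+ (n.-1 - m) * p = z ^+ m *: (q * jordan_poly z ^+ n.-1).
  rewrite ep XE exprZn -!scalerAr; congr (_ *: _).
  by rewrite mulrCA -exprD subnK // -ltnS prednK.
rewrite opolyZ opolyM -/(jordan_vec T w z n.-1).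
have Tv : T (jordan_vec T w z n.-1) = z *: jordan_vec T w z n.-1.
  by rewrite (T_jordan_vec _ _ z1) prednK // wn addr0.
rewrite (opoly_eigen _ Tv) => /eqP; rewrite !scaler_eq0 (negPf wn1) orbF.
by rewrite -rootE (negPf qz) orbF expf_eq0 (negPf (eigenvalue_neq0 z1)) andbF.
Qed.

Lemma left_inv_shift y : exists a, L y = T y + a *: w.
Proof. by exists (- (defect_weight w * hdot (T y) w)); rewrite LE scaleNr. Qed.

Lemma left_inv_shiftV y : exists a, T y = L y + a *: w.
Proof.
have [a ->] := left_inv_shift y; exists (- a).
by rewrite scaleNr addrK.
Qed.

Lemma opoly_left_inv_neq0 (p : {poly C}) : p != 0 -> (size p <= n)%N -> opoly L p w != 0.
Proof.
move=> p0 sp; have sp' : (size p <= (size p).-1.+1)%N by exact: leqSpred.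
have [s [ss cs <-]] := opoly_transfer left_inv_shiftV sp'.
apply: opoly_cyclic_neq0.
  apply: contra_eq_neq cs => ->; rewrite coef0 eq_sym -lead_coefE lead_coef_eq0 //.
by rewrite (leq_trans ss) // prednK // size_poly_gt0.
Qed.

Lemma left_inv_cyclic_inj p : L (opoly L p w) = 0 -> opoly L p w = 0.
Proof.
have [s [_ _ <-]] := opoly_transfer left_inv_shiftV (leqnSn (size p)).
rewrite LE => h; apply: (cyclic_inj wn); first by exists s.
by rewrite -[LHS](gram_invKV w) h hdot0l scale0r addr0.
Qed.

(** Transfer of (X - z)^n from T to L. *)
Lemma exists_min_poly : exists chi : {poly C},
  [/\ size chi = n.+1, chi`_n = 1, chi`_0 != 0 & opoly L chi w = 0].
Proof.
pose r := ('X - z%:P) ^+ n.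
have sr : size r = n.+1 by rewrite size_exp_XsubC.
have [chi [sc cn ec]] := opoly_transfer left_inv_shift (eq_leq sr).
have lr : r`_n = 1.
  have /monicP : r \is monic by rewrite monic_exp ?monicXsubC.
  by rewrite lead_coefE sr.
have cw : opoly L chi w = 0.
  rewrite ec /r; have -> : 'X - z%:P = z *: jordan_poly z by rewrite (jordan_polyE z1) scalerA z1 scale1r.
  by rewrite exprZn opolyZ -/(jordan_vec T w z n) wn scaler0.
have sc' : size chi = n.+1.
  apply/eqP; rewrite eqn_leq sc ltnNge; apply/negP => le.
  by have := nth_default 0 le; rewrite cn lr => /eqP; rewrite oner_eq0.
exists chi; split => //; first by rewrite cn lr.
apply/eqP => c0.
have /factor_theorem[q] : root chi 0 by rewrite rootE horner_coef0 c0.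
rewrite subr0 => eq.
have q0 : q != 0.
  by apply/eqP => q0; move: sc'; rewrite eq q0 mul0r size_poly0.
have sq : (size q <= n)%N by move: sc'; rewrite eq size_mulX // => -[->].
have := opoly_left_inv_neq0 q0 sq.
by rewrite left_inv_cyclic_inj ?eqxx // -opolyMX -eq.
Qed.

Lemma hdot_kernel_iter f l j : `|l| < 1 ->
  l ^+ j * hdot (iter j L f) (k_ l) =
  hdot f (k_ l) - \sum_(i < j) l ^+ i * hdot (iter i L f) e.
Proof.
move=> l1; elim: j => [|j ih]; first by rewrite mul1r big_ord0 subr0.
rewrite big_ord_recr /= opprD addrA -ih.
rewrite [in RHS](hdot_kernel_rec adjA TA LE e1 _ l1) exprSr; ring.
Qed.

Section Rational.
Variable chi : {poly C}.
Hypothesis size_chi : size chi = n.+1.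
Hypothesis chin : chi`_n = 1.
Hypothesis chi0 : chi`_0 != 0.
Hypothesis chiw : opoly L chi w = 0.

(** The reversal X^n chi(1/X). *)
Definition symbol_den : {poly C} := \poly_(i < n.+1) chi`_(n - i).

(** With vectors read as functions, X^j (L^j w) is w minus its first j Taylor
    terms; this turns X^n (chi(L) w) = 0 into an equation between w times
    [symbol_den] and this polynomial. *)
Definition symbol_num : {poly C} :=
  \sum_(j < n.+1) chi`_j *: \sum_(i < j) hdot (iter i L w) e *: 'X^(n - j + i).

Lemma symbol_denE l : symbol_den.[l] = \sum_(j < n.+1) chi`_j * l ^+ (n - j).
Proof.
rewrite horner_poly (reindex_inj rev_ord_inj) /=; apply: eq_bigr => j _.
by rewrite subSS subKn // -ltnS.
Qed.

Lemma symbol_numE l : symbol_num.[l] =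
  \sum_(j < n.+1) chi`_j * (l ^+ (n - j) * \sum_(i < j) l ^+ i * hdot (iter i L w) e).
Proof.
rewrite horner_sum; apply: eq_bigr => j _; rewrite hornerZ horner_sum.
by congr (_ * _); rewrite mulr_sumr; apply: eq_bigr => i _; rewrite hornerZ hornerXn exprD; ring.
Qed.

Lemma symbol_equation l : `|l| < 1 -> symbol_den.[l] * hdot w (k_ l) = symbol_num.[l].
Proof.
move=> l1; rewrite symbol_denE symbol_numE mulr_suml; apply/eqP.
rewrite -subr_eq0 -sumrB; apply/eqP.
have := congr1 (fun x => l ^+ n * hdot x (k_ l)) chiw.
rewrite hdot0l mulr0 /opoly size_chi hdot_suml mulr_sumr => h.
rewrite -[RHS]h; apply: eq_bigr => j _.
rewrite hdotZl -mulrA -mulrBr -mulrBr -hdot_kernel_iter // (mulrA (l ^+ _)) -exprD.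
by rewrite subnK ?(leq_ord j) // mulrCA.
Qed.

Lemma symbol_den0 : symbol_den.[0] = 1.
Proof. by rewrite horner_coef0 coef_poly subn0. Qed.

Lemma size_symbol_den : size symbol_den = n.+1.
Proof. by rewrite size_poly_eq // subnn. Qed.

Lemma size_symbol_num : (size symbol_num <= n)%N.
Proof.
rewrite /symbol_num; elim/big_ind: _ => [|p q sp sq|j _]; first by rewrite size_poly0.
  by rewrite (leq_trans (size_polyD _ _)) // geq_max sp.
rewrite (leq_trans (size_scale_leq _ _)) //.
elim/big_ind: _ => [|p q sp sq|i _]; first by rewrite size_poly0.
  by rewrite (leq_trans (size_polyD _ _)) // geq_max sp.
rewrite (leq_trans (size_scale_leq _ _)) // size_polyXn.
have := ltn_ord i; have := ltn_ord j; lia.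
Qed.

(** At a common root x put y = 1/x; then chi = s (X - y), so v = s(L) w is an
    eigenvector of L for y, nonzero by minimality of chi.  Summation by parts
    identifies the numerator at x with x^(n-1) <v, e>, so all the coefficients
    <L^j v, e> vanish and v = 0, a contradiction. *)
Lemma symbol_no_common_root x : x != 0 -> symbol_num.[x] = 0 -> symbol_den.[x] != 0.
Proof.
move=> x0 numx; apply/eqP => denx.
pose y := x^-1.
have xy k : (k <= n)%N -> x ^+ (n - k) = x ^+ n * y ^+ k.
  by move=> kn; rewrite exprB ?unitfE // /y exprVn.
have xn0 : x ^+ n != 0 by rewrite expf_eq0 (negPf x0) andbF.
have /factor_theorem[s es] : root chi y.
  move: denx; rewrite symbol_denE => /eqP.
  rewrite rootE horner_coef size_chi.
  under eq_bigr => j _ do rewrite xy ?(leq_ord j) // mulrCA.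
  by rewrite -mulr_sumr mulf_eq0 (negPf xn0).
have s0 : s != 0.
  by apply/eqP => s0; move: size_chi; rewrite es s0 mul0r size_poly0.
have ss : size s = n.
  by move: size_chi; rewrite es size_Mmonic ?monicXsubC // size_XsubC addn2 => -[].
pose v := opoly L s w.
have Lv : L v = y *: v.
  apply/eqP; rewrite -subr_eq0 -[X in _ == X]chiw es mulrBr (mulrC _ y%:P) mul_polyC.
  by rewrite opolyB opolyZ opolyMX.
have ve : hdot v e = 0.
  pose G j := \sum_(i < j) x ^+ i * hdot (iter i L w) e.
  have GS j : G j.+1 = G j + x ^+ j * hdot (iter j L w) e by rewrite /G big_ord_recr.
  have := numx; rewrite symbol_numE.
  under eq_bigr => j _ do rewrite -/(G j) xy ?(leq_ord j) // -mulrA mulrCA.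
  rewrite -mulr_sumr => /eqP; rewrite mulf_eq0 (negPf xn0) /= => /eqP hG.
  have : \sum_(j < n) s`_j * (y ^+ j.+1 * G j.+1) -
         \sum_(j < n) s`_j * (y ^+ j.+1 * G j) = 0.
    rewrite -[RHS]hG es.
    under [in RHS]eq_bigr => j _ do
      rewrite mulrBr coefB coefMX (mulrC s) mul_polyC coefZ mulrBl.
    rewrite sumrB big_ord_recl /= mul0r add0r; congr (_ - _).
    rewrite big_ord_recr /= [s`_n]nth_default ?ss // mulr0 mul0r addr0.
    by apply: eq_bigr => j _; rewrite exprS; ring.
  rewrite -sumrB => h.
  have : y * hdot v e = 0.
    rewrite -[RHS]h /v /opoly hdot_suml ss mulr_sumr; apply: eq_bigr => j _.
    rewrite GS hdotZl exprS.
    have yx : y ^+ j * x ^+ j = 1 by rewrite -exprMn mulVf // expr1n.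
    rewrite -!mulrBr addrC addKr -mulrA (mulrA (y ^+ j)) yx mul1r; ring.
  by move/eqP; rewrite mulf_eq0 invr_eq0 (negPf x0) => /eqP.
have : v = 0.
  apply: obs => j.
  have -> : iter j L v = y ^+ j *: v.
    elim: j => [|j ih]; first by rewrite scale1r.
    by rewrite /= ih linearZ /= Lv scalerA exprSr.
  by rewrite hdotZl ve mulr0.
by apply/eqP; rewrite opoly_left_inv_neq0 // ss.
Qed.

End Rational.

Lemma exists_rational_symbol : exists p q : {poly C},
  [/\ coprimep p q, maxn (size p).-1 (size q).-1 = n, p.[0] = 0 &
   forall l, `|l| < 1 -> q.[l] != 0 /\
     p.[l] / q.[l] = sqrtC (defect_weight w) * l * hdot w (k_ l)].
Proof.
have [chi [sc cn c0 cw]] := exists_min_poly.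
set s := sqrtC _.
have s0 : s != 0 by rewrite sqrtC_eq0 gt_eqF // defect_weight_gt0.
pose p := s *: ('X * symbol_num chi); pose q := symbol_den chi.
have pE l : p.[l] = s * (l * (symbol_num chi).[l]) by rewrite hornerZ hornerM hornerX.
have pq x : root p x -> q.[x] != 0.
  rewrite rootE pE !mulf_eq0 (negPf s0) /=.
  have [->|x0] /= := eqVneq x 0; first by rewrite symbol_den0 // oner_eq0.
  by move=> /eqP; apply: symbol_no_common_root.
exists p, q; split.
- exact: Pdiv.ClosedField.root_coprimep.
- rewrite size_symbol_den //=; apply/maxn_idPr.
  rewrite -subn1 leq_subLR add1n (leq_trans (size_scale_leq _ _)) //.
  rewrite mulrC; have [->|P0] := eqVneq (symbol_num chi) 0.
    by rewrite mul0r size_poly0.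
  by rewrite size_mulX // ltnS size_symbol_num.
- by rewrite pE mul0r mulr0.
- move=> l l1; have eqn := symbol_equation sc cw l1.
  have ql : q.[l] != 0.
    apply/eqP => ql; have : root p l by rewrite rootE pE -eqn -/q ql mul0r !mulr0.
    by move/pq; rewrite ql eqxx.
  split => //; rewrite pE -eqn -/q.
  by field.
Qed.

End Symbol.

(** * The theorem *)

Lemma derivable_horner (F : numFieldType) (p : {poly F}) (x : F) :
  derivable (fun y : F => p.[y]) x 1.
Proof.
elim/poly_ind: p => [|p c ih].
  under eq_fun do rewrite horner0; exact: derivable_cst.
under eq_fun do rewrite hornerMXaddC.
apply: derivableD; last exact: derivable_cst.
by apply: derivableM => //; exact: derivable_id.
Qed.

Theorem theorem0p1 (R : realType) (n : nat) (H : hilbertType R)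
    (A : {linear H -> H}) (w : H)
    (hn : (1 <= n)%N)
    (hbounded : bounded_op A)
    (hquasi : quasi_analytic A)
    (hstrict : strict_m_isometry (2 * n) A)
    (hrank : forall x : H, adjoint A (A x) - x = rank_one w w x) :
  exists b : Cplx R -> Cplx R,
    [/\ rational_of_degree n b, in_Hinfty_ball b, b 0 = 0
      & unitarily_equivalent_Mz_dBR A b].
Proof.
have adjA' := adjointP (linearP A) hbounded.
have [T TE] : exists T : {linear H -> H}, T =1 adjoint A.
  apply: linear_map_exists => a x y; apply: hdotl_inj => v.
  by rewrite -adjA' !hdotDr !hdotZr -!adjA'.
have adjE : adjoint A =1 T by move=> x; rewrite TE.
have adjA x y : hdot (A x) y = hdot x (T y) by rewrite TE.
have TA x : T (A x) = x + hdot x w *: w.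
  by rewrite TE -[LHS](subrK x) hrank addrC.
have [z [z1 wn wn1]] := adjoint_unipotent adjA TA adjE hn hstrict.
have w0 : w != 0.
  by apply: contraNneq wn1 => w0; rewrite /jordan_vec w0 opolyx0.
have [_ [E0 [S [hE hS [U [UI rU US]]]]]] := hquasi.
rewrite (invariant_span_cyclic z1 wn w0 adjE hrank) in rU.
have [e [e1 Te kerT]] := kernel_adjoint_line adjA z1 wn hE hS UI rU US.
have [L LE] : exists L : {linear H -> H}, L =1 (fun x => gram_inv w (T x)).
  by apply: linear_map_exists => a x y; rewrite linearP gram_inv_linear.
have obs f : (forall j, hdot (iter j L f) e = 0) -> f = 0.
  move=> hf; apply: (backward_orbit0 adjA TA z1 wn _ (f := fun j => iter j L f)).
    exact: (orthogonal_compl_pure adjA TA hE hS UI rU US).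
  move=> j; rewrite {1}(left_inv_decomp adjA TA LE e1 Te kerT (iter j L f)) hf.
  by rewrite scale0r addr0.
have [p [q [copq degpq p0 pqE]]] :=
  exists_rational_symbol adjA TA LE e1 z1 hn wn wn1 obs.
pose ev (f : H) (l : Cplx R) := hdot f (kernel_vec A w e l).
have evl (a : Cplx R) (f g : H) (l : Cplx R) : `|l| < 1 ->
    ev (a *: f + g) l = a * ev f l + ev g l.
  by move=> _; rewrite /ev hdotDl hdotZl.
have evi (f : H) : (forall l, `|l| < 1 -> ev f l = 0) -> f = 0.
  by move=> hf; apply: obs; apply: (kernel_transform_coef adjA TA LE e1).
(* The model space is H itself, so the unitary is the identity. *)
pose E := DiscSpace evl evi.
pose b (l : Cplx R) := p.[l] / q.[l].
have bE l : `|l| < 1 -> b l = sqrtC (defect_weight w) * l * ev w l.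
  by move=> /pqE[].
have kernelE l l' : `|l| < 1 -> `|l'| < 1 ->
    ev (kernel_vec A w e l) l' * (1 - l^* * l') = 1 - (b l)^* * b l'.
  move=> h h'; rewrite (hdot_kernel2 adjA TA e1 Te h h') !bE // !rmorphM /=.
  have sc : (sqrtC (defect_weight w))^* = sqrtC (defect_weight w).
    by apply/CrealP; rewrite ger0_real // sqrtC_ge0 ltW // defect_weight_gt0.
  rewrite sc /ev -(hdotC (kernel_vec A w e l) w).
  move: (sqrtC _) (sqrtCK (defect_weight w)) sc => s <- _; ring.
exists b; split.
- by exists p, q; split => // l /pqE[].
- move=> l l1; have [ql _] := pqE l l1; split.
    apply: derivableM; first exact: derivable_horner.
    by apply: derivableV => //; exact: derivable_horner.
  have := kernelE l l l1 l1.
  have h1 : 0 <= 1 - l^* * l.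
    by rewrite mulrC -normCK subr_ge0 expr_le1 // ltW.
  move=> E1; have : 0 <= 1 - (b l)^* * b l by rewrite -E1 mulr_ge0 // hdotxx_ge0.
  by rewrite mulrC -normCK subr_ge0 expr_le1.
- by rewrite /b p0 mul0r.
- exists E, A; split => //.
  + move=> l l1; exists (kernel_vec A w e l); split => // l' l1'.
    rewrite /dBR_kernel -kernelE // mulfK // subr_eq0 eq_sym; apply/eqP => h.
    have : `|l^* * l'| < 1 by rewrite normrM norm_conjC mulr_ilt1.
    by rewrite h normr1 ltxx.
  + by move=> f l l1; exact: (hdot_A_kernel adjA TA LE e1 Te).
  + exists (idfun : {linear H -> H}); split => //.
    by apply/seteqP; split => // x _; exists x.
Qed.
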